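(* For every $\gamma>0$ there is a constant $K$, depending on $\gamma$ only, such that the following holds. Let $\mathcal F$ be a family of $N$-tuples $\alpha=(\alpha_i)_{i\le N}$ of positive numbers, and let $(X_i)_{i\le N}$ be independent identically distributed nonnegative random variables. Let $\psi$ be a convex function on $\mathbb R^+$ with $\psi(0)=0$, $\psi(x)\le x^2$ for $x\le1$, $\psi(x)\ge x$ for $x\ge1$. Let $\theta$, with inverse function $\xi$, be as in the context, and let $w\ge0$ be a nonincreasing function on $]0,1]$ with $w\le\theta$ and $\int_0^1w^2\,d\lambda\le1$. Assume that $\xi''$ is decreasing, that $\xi''(b)\le|\xi'(b)|$ for all $b>0$, that $|\xi'(b+1)|\ge\gamma|\xi'(b)|$ for all $b\ge0$, that $|\theta'(1)|\ge\gamma$ and $w(1/2)\ge\gamma$, and that condition $H(\xi,w)$ holds. Assume that the median $m$ of $X_1$ is $\le1$, and that for $t\ge m$, $$w(P(X_1\ge t))\ge\psi(t).$$ Then, if $M$ is a median of $Z'=\inf_{\alpha\in\mathcal F}\sum_{i\le N}\alpha_iX_i$, we have $$u\ge0\ \Rightarrow\ P(Z'\le M-u)\le\exp\Big(\theta\big(\tfrac12\big)-\frac1K\Psi_{\mathcal F}(u)\Big),$$ $$u\ge0\ \Rightarrow\ P(Z'\ge M+u)\le\xi\Big(\frac1K\Psi_{\mathcal F}(u)-\log2\Big).$$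
   Context: Functions $\theta,\xi$: $\theta$ is a convex decreasing function from $]0,1]$ to $\mathbb R^+$ with $\theta(1)=0$ and $\lim_{x\to0}\theta(x)=\infty$, and $\xi:\mathbb R^+\to]0,1]$ is its inverse function (convex, $\xi(0)=1$). When the argument of $\xi$ in the last inequality is negative, $\xi$ is read as $1$ (the bound is then trivial). The value $w(0)$ is read as $+\infty$. Condition $H(\xi,w)$: with $x^+=\max(x,0)$ and, for $x\in\mathbb R$, $b\ge0$, $\Xi(x,b)=\xi(x^+)-\xi(b)-(x^+-b)\xi'(b)$, the condition is that for all $b\ge0$ and all $0\le t\le1$, $$\int_0^1\Xi(b-tw(u),b)\,d\lambda(u)\le t^2|\xi'(b)|,$$ $\lambda$ being Lebesgue measure on $[0,1]$. For $u>0$, $$\Psi_{\mathcal F}(u)=\inf\Big\{\sum_{i\le N}\psi(s_i): s_i\ge 0,\ \exists\alpha\in\mathcal F,\ \sum_{i\le N}s_i|\alpha_i|\ge u\Big\}.$$ *)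

(* Defs.v *)
From HB Require Import structures.
From mathcomp Require Import all_boot all_order all_algebra.
From mathcomp Require Import all_classical all_reals all_analysis.

Set Implicit Arguments.
Unset Strict Implicit.
Unset Printing Implicit Defensive.

Import Order.TTheory GRing.Theory Num.Theory.
Import numFieldNormedType.Exports.

Local Open Scope classical_set_scope.
Local Open Scope ring_scope.

Section Deviation.
Context {R : realType}.
Implicit Types (theta xi dxi ddxi w psi f : R -> R) (x b t u l m : R).

Definition is_rderive f x l : Prop := (f y - f x) / (y - x) @[y --> x^'+] --> l.

Definition is_lderive f x l : Prop := (f y - f x) / (y - x) @[y --> x^'-] --> l.

(* theta : ]0,1] -> [0,+oo[; its values outside ]0,1] play no role. *)
Definition convex_decreasing_theta theta : Prop :=
  [/\ convex_function (`]0, 1]%classic : set R^o) theta,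
      {in `]0, 1]%R, forall x, 0 <= theta x},
      {in `]0, 1]%R &, {homo theta : x y /~ x < y}},
      theta 1 = 0
    & theta x @[x --> 0^'+] --> +oo].

(* xi : [0,+oo[ -> ]0,1] is the inverse bijection of theta; its values on
   negative reals play no role. *)
Definition inverse_of theta xi : Prop :=
  [/\ {in `[0, +oo[%R, forall b, xi b \in `]0, 1]%R},
      {in `[0, +oo[%R, forall b, theta (xi b) = b}
    & {in `]0, 1]%R, forall x, xi (theta x) = x}].

(* dxi is the derivative of xi on [0,+oo[ (from the right at 0), and ddxi its
   second derivative on ]0,+oo[. *)
Definition derivatives_of xi dxi ddxi : Prop :=
  [/\ is_rderive xi 0 (dxi 0),
      (forall b, 0 < b -> is_derive b 1 xi (dxi b))
    & (forall b, 0 < b -> is_derive b 1 dxi (ddxi b))].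

Definition Xi xi dxi x b : R :=
  xi (Num.max x 0) - xi b - (Num.max x 0 - b) * dxi b.

(* w is a function on ]0,1]; omitting the null point 0 of [0,1] does not change
   the integral. For b = 0, dxi b is the right derivative. *)
Definition condH xi dxi w : Prop :=
  forall b t, 0 <= b -> 0 <= t <= 1 ->
    (\int[lebesgue_measure]_(u in `]0%R, 1%R]) (Xi xi dxi (b - t * w u) b)%:E
       <= (t ^+ 2 * `|dxi b|)%:E)%E.

(* w extended by w(0) = +oo *)
Definition w_ext w x : \bar R := if x == 0 then +oo%E else (w x)%:E.

(* xi extended by 1 to the negative reals *)
Definition xi_ext xi x : R := if x < 0 then 1 else xi x.

Definition PsiF (N : nat) (F : set ('I_N -> R)) psi u : R :=
  inf [set \sum_(i < N) psi (s i) | s in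
       [set s : 'I_N -> R | (forall i, 0 <= s i) /\
          exists2 a, F a & u <= \sum_(i < N) s i * `|a i|]].

(* A real infimum, meaningful for F nonempty and nonnegative data. *)
Definition Zinf (T : Type) (N : nat) (F : set ('I_N -> R))
    (X : 'I_N -> T -> R) (x : T) : R :=
  inf [set \sum_(i < N) a i * X i x | a in F].

Definition is_median d (T : measurableType d) (P : probability T R)
    (Z : T -> R) m : Prop :=
  ((2^-1)%:E <= P [set x | (Z x <= m)%R])%E /\
  ((2^-1)%:E <= P [set x | (m <= Z x)%R])%E.

Definition mutually_independent d (T : measurableType d) (P : probability T R)
    (N : nat) (X : 'I_N -> T -> R) : Prop :=
  forall (J : {set 'I_N}) (B : 'I_N -> set R), (forall i, measurable (B i)) ->
    P (\bigcap_(i in [set` J]) (X i @^-1` B i)) =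
    (\prod_(i in J) P (X i @^-1` B i))%E.

Definition identically_distributed d (T : measurableType d)
    (P : probability T R) (N : nat) (X : 'I_N -> T -> R) : Prop :=
  forall (i j : 'I_N) (B : set R), measurable B ->
    P (X i @^-1` B) = P (X j @^-1` B).

End Deviation.

(* Main.v *)
(* Z' is an infimum of linear forms with positive coefficients, hence concave,
   nondecreasing and positively homogeneous on the orthant. The core is the
   inequality  E exp(Qc) <= exp(theta(E xi(c)))  for c >= 0 convex and
   nonincreasing, where Qc is the infimal convolution of c with the cost
   kappa * sum_i psi((x_i - y_i)^+). It tensorizes: convexity of c and
   Hoelder's inequality reduce it to one variable, for functions C that need
   only be nonincreasing. In one variable one expands around a reference level
   b close to the value of C at the median: below the median the infimal
   convolution gains a multiple of tau^2, tau being the largest drop of C below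
   b in units of w, and this pays for the second order error above the median,
   which H(xi,w) and the bound on the integral of w^2 keep below 3 tau^2.
   Applying the inequality to c = L (a - Z')^+ with L large and comparing the
   levels a and a - u gives  P(Z' >= a) <= xi(log P(Z' <= a - u) + kappa Psi(u)),
   from which both tail bounds follow.

   The X_i are first rounded down to a finite grid. This makes all expectations
   finite sums and, Z' being nondecreasing and homogeneous, Z' of the rounded
   vector converges to Z'. Rounding down preserves the hypothesis relating w
   to the tail of X_1. *)

Require Import Defs.
From HB Require Import structures.
From mathcomp Require Import all_boot all_order all_algebra.
From mathcomp Require Import all_classical all_reals all_analysis.
From mathcomp Require Import measurable_realfun ring lra zify.

Set Implicit Arguments.
Unset Strict Implicit.
Unset Printing Implicit Defensive.

Import Order.TTheory GRing.Theory Num.Theory.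
Import numFieldNormedType.Exports.

Local Open Scope classical_set_scope.
Local Open Scope ring_scope.

(** * Convexity of [xi], its tangent lines, and the decay rate of its derivative *)

Section InverseFunction.
Context {R : realType} (theta xi dxi ddxi : R -> R).
Hypotheses (htheta : convex_decreasing_theta theta)
  (hxi : inverse_of theta xi) (hd : derivatives_of xi dxi ddxi)
  (hdd : forall b, 0 < b -> ddxi b <= `|dxi b|).

Lemma xi_gt0_le1 b : 0 <= b -> 0 < xi b <= 1.
Proof.
by move=> b0; case: hxi => /(_ b) + _ _; rewrite !in_itv/= b0 => /(_ isT).
Qed.

Lemma theta_xi b : 0 <= b -> theta (xi b) = b.
Proof. by move=> b0; case: hxi => _ /(_ b) + _; rewrite in_itv/= b0; exact. Qed.

Lemma xi_theta x : 0 < x <= 1 -> xi (theta x) = x.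
Proof. by move=> x01; case: hxi => _ _ /(_ x); rewrite in_itv/= x01; exact. Qed.

Lemma theta_ge0 x : 0 < x <= 1 -> 0 <= theta x.
Proof. by move=> x01; case: htheta => _ /(_ x) + _ _ _; rewrite in_itv/= x01; exact. Qed.

Lemma theta_le x y : 0 < x -> x <= y -> y <= 1 -> theta y <= theta x.
Proof.
move=> x0; rewrite le_eqVlt => /predU1P[->//|xy] y1.
case: htheta => _ _ H _ _; apply/ltW/H => //; rewrite in_itv/=.
- by rewrite (lt_trans x0 xy) y1.
- by rewrite x0 (le_trans (ltW xy)).
Qed.

Lemma xi_le a b : 0 <= a -> a <= b -> xi b <= xi a.
Proof.
move=> a0 ab; have b0 := le_trans a0 ab.
rewrite leNgt; apply/negP => ltx.
have /andP[xa _] := xi_gt0_le1 a0; have /andP[_ xb] := xi_gt0_le1 b0.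
case: htheta => _ _ H _ _.
have : theta (xi b) < theta (xi a).
  apply: H => //; rewrite in_itv/=; first by rewrite (lt_trans xa) ?xb.
  by rewrite xa (le_trans (ltW ltx)).
by rewrite !theta_xi// ltNge ab.
Qed.

Lemma xi0 : xi 0 = 1.
Proof.
by case: htheta => _ _ _ t1 _; rewrite -t1 xi_theta// ltr01 lexx.
Qed.

(** Convexity of [theta] bounds [theta] of the right side by [t * a + (1 - t) * b]; applying the
    decreasing [xi] reverses this. *)
Lemma xi_convex t a b : 0 <= t <= 1 -> 0 <= a -> 0 <= b ->
  xi (t * a + (1 - t) * b) <= t * xi a + (1 - t) * xi b.
Proof.
move=> /andP[t0 t1] a0 b0.
have /andP[xa0 xa1] := xi_gt0_le1 a0; have /andP[xb0 xb1] := xi_gt0_le1 b0.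
case: htheta => cth _ _ _ _.
have tI : Itv.spec (@Itv.num_sem R) (Itv.Real `[0%Z, 1%Z]) t.
  by apply/and3P; split; rewrite ?num_real// bnd_simp.
pose t' : {i01 R} := Itv.mk tI.
have := cth t' (xi a) (xi b); rewrite !inE/= !in_itv/= xa0 xa1 xb0 xb1.
move=> /(_ isT isT); rewrite !convRE/= !theta_xi// => hle.
set y := t * xi a + (1 - t) * xi b.
have y01 : 0 < y <= 1.
  rewrite /y; nra.
by rewrite -(xi_theta y01); apply: xi_le => //; exact: theta_ge0.
Qed.


Lemma xi_slope b y h : 0 <= b -> b < y -> 0 < h -> h < y - b ->
  h^-1 * (xi (h + b) - xi b) <= (xi y - xi b) / (y - b).
Proof.
move=> b0 by0 h0 hy; have yb : 0 < y - b by rewrite subr_gt0.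
have t01 : 0 <= h / (y - b) <= 1.
  by rewrite divr_ge0 ?(ltW h0) ?(ltW yb)// ler_pdivrMr// mul1r ltW.
have := xi_convex t01 (le_trans b0 (ltW by0)) b0.
have -> : h / (y - b) * y + (1 - h / (y - b)) * b = h + b.
  by field; rewrite gt_eqF.
move=> H; rewrite ler_pdivrMl//.
have -> : h * ((xi y - xi b) / (y - b)) = h / (y - b) * xi y + (1 - h / (y - b)) * xi b - xi b.
  by field; rewrite gt_eqF.
by rewrite lerD2r.
Qed.

Lemma xi_slope_left b y h : 0 <= y -> y < b -> h < 0 -> y - b < h ->
  (xi y - xi b) / (y - b) <= h^-1 * (xi (h + b) - xi b).
Proof.
move=> y0 yb h0 hy; have yb' : 0 < b - y by rewrite subr_gt0.
have t01 : 0 <= - h / (b - y) <= 1.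
  rewrite divr_ge0 ?oppr_ge0 ?(ltW h0) ?(ltW yb')// ler_pdivrMr// mul1r.
  by rewrite lerNl opprB ltW.
have := xi_convex t01 y0 (le_trans y0 (ltW yb)).
have -> : - h / (b - y) * y + (1 - - h / (b - y)) * b = h + b.
  by field; rewrite gt_eqF.
move=> H; rewrite ler_ndivlMl//.
have -> : h * ((xi y - xi b) / (y - b)) = - h / (b - y) * xi y + (1 - - h / (b - y)) * xi b - xi b.
  by field; rewrite ?(lt_eqF h0) !subr_eq0 (lt_eqF yb) (gt_eqF yb).
by rewrite lerD2r.
Qed.

Lemma xi_dquot b : 0 < b ->
  h^-1 * (xi (h + b) - xi b) @[h --> 0^'] --> dxi b.
Proof.
move=> b0; case: hd => _ /(_ _ b0) [hder <-] _.
rewrite [X in X @ _ --> _](_ : _ = (fun h => h^-1 *: (xi (h *: 1 + b) - xi b))) //.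
by apply/funext => h; rewrite /GRing.scale/= mulr1.
Qed.

Lemma xi_dquot_right b : 0 <= b ->
  h^-1 * (xi (h + b) - xi b) @[h --> 0^'+] --> dxi b.
Proof.
rewrite le_eqVlt => /predU1P[<-|b0].
  case: hd => + _ _; rewrite /is_rderive.
  by under eq_fun do rewrite subr0 mulrC; under [in X in _ -> X]eq_fun do rewrite addr0.
by have /cvg_dnbhs_at_right := xi_dquot b0.
Qed.

(** Chord slopes are compared with their limit at [b]: from the right for [y > b], which covers
    [b = 0], and from the left for [y < b], where [b > 0]. *)
Lemma xi_tangent b y : 0 <= b -> 0 <= y -> xi b + dxi b * (y - b) <= xi y.
Proof.
move=> b0 y0; case: (ltgtP b y) => [by0|yb|->]; last by rewrite subrr mulr0 addr0.
- rewrite addrC -lerBrDr -ler_pdivlMr ?subr_gt0//.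
  apply: (cvgr_to_le (xi_dquot_right b0)); near=> h; apply: xi_slope => //.
  by near: h; apply: nbhs_right_lt; rewrite subr_gt0.
- have bp : 0 < b by rewrite (le_lt_trans y0).
  rewrite addrC -lerBrDr -ler_ndivrMr ?subr_lt0//.
  have /cvg_dnbhs_at_left hl := xi_dquot bp.
  apply: (cvgr_to_ge hl); near=> h; apply: xi_slope_left => //.
  by near: h; apply: nbhs_left_gt; rewrite subr_lt0.
Unshelve. all: by end_near. Qed.

Lemma dxi_le0 b : 0 <= b -> dxi b <= 0.
Proof.
move=> b0; have := @xi_tangent b (b + 1) b0.
rewrite addrAC subrr add0r mulr1 addr_ge0// => /(_ isT).
have := @xi_le b (b + 1) b0; rewrite lerDl ler01 => /(_ isT).
by move: (xi b) (xi (b + 1)) (dxi b) => x y z; lra.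
Qed.

(** [dxi 0] is the steepest slope: the tangents at 0 and at [y'], each evaluated at the other point,
    give [dxi 0 <= dxi y']. *)
Lemma xi_lipschitz y y' : 0 <= y' -> y' <= y -> xi y' <= xi y - dxi 0 * (y - y').
Proof.
rewrite le_eqVlt => /predU1P[<- y0|y'0 y'y].
  have := xi_tangent (lexx 0) y0; lra.
have h1 := xi_tangent (lexx 0) (ltW y'0).
have h2 := xi_tangent (ltW y'0) (lexx 0).
have h3 := xi_tangent (ltW y'0) (le_trans (ltW y'0) y'y).
have h4 : dxi 0 <= dxi y' by nra.
nra.
Qed.

(** The derivative of [expR * dxi] is [expR * (ddxi + dxi)], and [ddxi <= - dxi]. So the slope of
    [xi] decays no faster than [expR (- b)]. *)
Lemma expR_dxi_nonincr b c : 0 < b -> b <= c -> expR c * dxi c <= expR b * dxi b.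
Proof.
move=> b0 bc.
have dF (x : R) : 0 < x -> is_derive x 1 (expR * dxi) (expR x * (ddxi x + dxi x)).
  move=> x0; case: hd => _ _ /(_ _ x0) hx.
  by apply: is_derive_eq; rewrite /GRing.scale/=; ring.
apply: (@ler0_derive1_nincr R (expR * dxi) b c) => //.
- move=> x; rewrite in_itv/= => /andP[bx _].
  by have [] := dF x (lt_trans b0 bx).
- move=> x; rewrite in_itv/= => /andP[bx _].
  have x0 := lt_trans b0 bx.
  rewrite derive1E; have [_ ->] := dF x x0.
  have := hdd x0; rewrite ler0_norm ?dxi_le0 ?(ltW x0)// => h.
  by rewrite mulr_ge0_le0 ?expR_ge0//; lra.
- apply: derivable_within_continuous => x; rewrite in_itv/= => /andP[bx _].
  by have [] := dF x (lt_le_trans b0 bx).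
Qed.

(** Integrated form of the decay estimate: the derivative of [F] at [x] is
    [dxi x - expR (b - x) * dxi b], which is nonpositive for [x >= b]. *)
Lemma xi_exp_bound_pos b e : 0 < b -> 0 <= e ->
  xi (b + e) <= xi b + dxi b * (1 - expR (- e)).
Proof.
move=> b0 e0.
pose F := (fun s => xi s + expR b * dxi b * expR (- s)).
have dF (x : R) : 0 < x -> is_derive x 1 F (dxi x - expR b * dxi b * expR (- x)).
  move=> x0; case: hd => _ /(_ _ x0) hx _.
  by apply: is_derive_eq; rewrite /GRing.scale/=; ring.
have := @ler0_derive1_nincr R F b (b + e) _ _ _ b (b + e).
have h1 : (forall x : R, x \in `]b, (b + e)[%R -> derivable F x 1).
  move=> x; rewrite in_itv/= => /andP[bx _].
  by have [] := dF x (lt_trans b0 bx).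
have h2 : (forall x : R, x \in `]b, (b + e)[%R -> derive1 F x <= 0).
  move=> x; rewrite in_itv/= => /andP[bx _]; have x0 := lt_trans b0 bx.
  rewrite derive1E; have [_ ->] := dF x x0.
  have h := expR_dxi_nonincr b0 (ltW bx).
  by rewrite subr_le0 expRN ler_pdivlMr ?expR_gt0// mulrC.
have h3 : {within `[b, (b + e)], continuous F}.
  apply: derivable_within_continuous => x; rewrite in_itv/= => /andP[bx _].
  by have [] := dF x (lt_le_trans b0 bx).
move=> /(_ h1 h2 h3); rewrite lexx lerDl e0 => /(_ isT isT (lexx _)).
rewrite /F (mulrAC (expR b)) -expRD (mulrAC (expR b) (dxi b)) -expRD subrr expR0.
rewrite opprD addrA subrr add0r mul1r mulrBr mulr1 (mulrC (dxi b)).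
by move: (_ * dxi b) => z; move: (xi b) (xi (b + e)) (dxi b) => *; lra.
Qed.

(** The same monotonicity down to the end point 0, where only the right derivative of [xi] is
    available. Tangents at 0 and at a small [r] bound the increment of [xi] from 0 to [s] from
    below. *)
Lemma expR_dxi_le0 b : 0 < b -> expR b * dxi b <= dxi 0.
Proof.
move=> b0; apply: (cvgr_to_ge (xi_dquot_right (lexx 0))); near=> s.
have s0 : 0 < s by [].
have sb : s < b by near: s; exact: nbhs_right_lt.
rewrite addr0 ler_pdivlMl//.
apply/ler_addgt0Pr => e e0.
have d0 : 0 <= - dxi 0 by rewrite oppr_ge0 dxi_le0.
(* [r] is so small that the part of the increment over [[0, r]] costs at most [e]. *)
pose r := Num.min s (e / (1 + - dxi 0 + - (expR b * dxi b))).
have eb : 0 <= - (expR b * dxi b).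
  by rewrite oppr_ge0 mulr_ge0_le0 ?expR_ge0// dxi_le0// ltW.
have D0 : 0 < 1 + - dxi 0 + - (expR b * dxi b) by lra.
have r0 : 0 < r by rewrite lt_min s0 divr_gt0.
have re : r * (1 + - dxi 0 + - (expR b * dxi b)) <= e.
  by rewrite -ler_pdivlMr// /r ge_min lexx orbT.
have rs : r <= s by rewrite /r ge_min lexx.
have h1 := xi_tangent (lexx 0) (ltW r0).
have h5 := @xi_tangent r s (ltW r0) (ltW s0).
have h6 := expR_dxi_nonincr r0 (ltW (le_lt_trans rs sb)).
have h7 : expR b * dxi b <= dxi r.
  apply: (le_trans h6); rewrite -[X in _ <= X]mul1r ler_wnM2r ?dxi_le0 ?(ltW r0)//.
  by rewrite -expR0 ler_expR ltW.
have h8 : expR b * dxi b * (s - r) <= dxi r * (s - r).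
  by rewrite ler_wpM2r// subr_ge0.
have h9 : 0 <= - (expR b * dxi b) * r by rewrite mulr_ge0 ?(ltW r0).
move: re h1 h5 h8 h9; move: (expR b * dxi b) => z.
by move: (xi s) (xi r) (xi 0) (dxi 0) (dxi r) => *; nra.
Unshelve. all: by end_near. Qed.

Lemma xi_exp_bound b e : 0 <= b -> 0 <= e ->
  xi (b + e) <= xi b + dxi b * (1 - expR (- e)).
Proof.
rewrite le_eqVlt => /predU1P[<-|b0] e0; last exact: xi_exp_bound_pos.
move: e0; rewrite le_eqVlt => /predU1P[<-|e0].
  by rewrite oppr0 expR0 subrr mulr0 !addr0.
rewrite add0r; apply/ler_addgt0Pr => eps eps0.
have d0 : 0 <= - dxi 0 by rewrite oppr_ge0 dxi_le0.
have D0 : 0 < 1 - dxi 0 by lra.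
pose r := Num.min e (eps / (1 - dxi 0)).
have r0 : 0 < r by rewrite lt_min e0 divr_gt0.
have re : r * (1 - dxi 0) <= eps by rewrite -ler_pdivlMr// /r ge_min lexx orbT.
have rs : r <= e by rewrite /r ge_min lexx.
have := @xi_exp_bound_pos r (e - r) r0; rewrite subr_ge0 => /(_ rs).
rewrite addrC subrK => h1.
have h2 : dxi r <= expR (- r) * dxi 0.
  by rewrite expRN -ler_pdivrMl ?invr_gt0 ?expR_gt0// invrK; exact: expR_dxi_le0.
have h3 := @xi_le 0 r (lexx _) (ltW r0).
have h4 : 0 <= 1 - expR (- (e - r)).
  by rewrite subr_ge0 -expR0 ler_expR oppr_le0 subr_ge0.
have h5 : dxi r * (1 - expR (- (e - r))) <= expR (- r) * dxi 0 * (1 - expR (- (e - r))).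
  by rewrite ler_wpM2r.
have h6 : expR (- r) * dxi 0 * (1 - expR (- (e - r))) = dxi 0 * (expR (- r) - expR (- e)).
  rewrite mulrAC mulrC mulrBr mulr1 -expRD; congr (_ * (_ - expR _)); ring.
have h7 := expR_ge1Dx (- r).
move: h1 h3 h5 h7 re; rewrite h6.
move: (xi e) (xi r) (xi 0) (dxi 0) d0 (expR (- r)) (expR (- e)) (dxi r * _) => x1 x2 x3 x4 hx4 x5 x6 x7 *.
nra.
Qed.

Lemma Xi_ge0 x b : 0 <= b -> 0 <= Xi xi dxi x b.
Proof.
move=> b0; have x0 : 0 <= Num.max x 0 by rewrite le_max lexx orbT.
have := xi_tangent b0 x0; rewrite /Xi mulrC.
by move: (xi _) (xi b) (_ * _) => *; lra.
Qed.

(** By convexity the slope of [xi] to the left of [b] is at most [dxi b], so the gap to the tangent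
    shrinks toward [b]. *)
Lemma Xi_nonincr x y b : 0 <= b -> x <= y -> y <= b ->
  Xi xi dxi y b <= Xi xi dxi x b.
Proof.
move=> b0 xy yb; rewrite /Xi.
have x0 : 0 <= Num.max x 0 by rewrite le_max lexx orbT.
have y0 : 0 <= Num.max y 0 by rewrite le_max lexx orbT.
have xy' : Num.max x 0 <= Num.max y 0 by rewrite ge_max !le_max xy lexx orbT.
have yb' : Num.max y 0 <= b by rewrite ge_max yb.
move: (Num.max x 0) (Num.max y 0) x0 y0 xy' yb' => {xy yb}x {}y x0 y0 xy yb.
have h1 := xi_tangent y0 x0.
have h2 := xi_tangent y0 b0.
have h3 := xi_tangent b0 y0.
have [->|ny] := eqVneq y b.
  by have := xi_tangent b0 x0; rewrite mulrC; move: (_ * _) => z; lra.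
have lyb : y < b by rewrite lt_neqAle ny.
have h4 : dxi y <= dxi b by nra.
nra.
Qed.

End InverseFunction.

(** * Elementary bounds on the exponential *)

Section ExpBounds.
Context {R : realType}.
Implicit Types z e x tau kappa g : R.

(** From [expR (- z) >= 1 - z] one gets [expR z <= (1 - z)^-1], and [1 - z] times the right side is
    [1 + z ^+ 2 * (1 - 2 * z)]. *)
Lemma expR_le_quadratic z : z <= 2^-1 -> expR z <= 1 + z + 2 * z ^+ 2.
Proof.
move=> z2.
have h := expR_ge1Dx (- z).
have p1 : 0 < 1 - z by lra.
have : expR z <= (1 - z)^-1.
  by rewrite -[z in expR z]opprK expRN lef_pV2 ?posrE ?expR_gt0//.
move=> /le_trans; apply.
rewrite -[X in X <= _]mul1r ler_pdivrMr//.
have : 0 <= z ^+ 2 * (1 - 2 * z) by rewrite mulr_ge0 ?sqr_ge0//; lra.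
by nra.
Qed.

(* In the next two lemmas [e] and [x] stand for [C i - b] and [D i - b], where
   [i] is below the median, and [tau] for the largest relative drop of [C]. *)
Lemma low_bound_gap g kappa tau e x : 0 < g <= 1 -> kappa = g ^+ 3 / 100 ->
  0 <= tau <= 2 * kappa / g -> 0 <= e -> x <= - (kappa * g) ->
  expR x <= 2 - expR (- e) - 6 * tau ^+ 2.
Proof.
move=> /andP[g0 g1] kE /andP[t0 t1] e0 hx.
have k0 : 0 < kappa by rewrite kE divr_gt0// exprn_gt0.
have tg : tau * g <= 2 * kappa by rewrite -ler_pdivlMr.
have te : tau <= g ^+ 2 / 50.
  rewrite (le_trans t1)// kE ler_pdivrMr//.
  lra.
have h1 : expR (- e) <= 1 by rewrite -expR0 ler_expR oppr_le0.
have h2 : expR x <= expR (- (kappa * g)) by rewrite ler_expR.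
have kg : 0 < kappa * g by rewrite mulr_gt0.
have kg1 : kappa * g <= 1 / 100.
  have : g ^+ 3 * g <= 1 by rewrite -exprSr exprn_ile1// ltW.
  by rewrite kE; lra.
have h3 := @expR_le_quadratic (- (kappa * g)).
have {}h3 : expR (- (kappa * g)) <= 1 - kappa * g + 2 * (kappa * g) ^+ 2.
  by rewrite (le_trans (h3 _))//; [lra|rewrite sqrrN].
(* Product of [tau * g <= 2 * kappa] and [tau <= g ^+ 2 / 50]; the linear gain [kappa * g] in
   [expR x] then outweighs [6 * tau ^+ 2]. *)
have h4 : tau ^+ 2 <= kappa * g / 25.
  have : tau ^+ 2 * g <= 2 * kappa * (g ^+ 2 / 50).
    rewrite expr2 -mulrA (mulrC tau) ler_pM// mulr_ge0// ltW//.
  rewrite (_ : 2 * kappa * (g ^+ 2 / 50) = kappa * g / 25 * g); last by field.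
  by rewrite ler_pM2r.
nra.
Qed.

Lemma low_bound g kappa tau e x : 0 < g <= 1 -> kappa = g ^+ 3 / 100 ->
  0 <= tau <= 2 * kappa / g -> 0 <= e ->
  (forall t, 0 <= t <= 1 -> x <= (1 - t) * e + kappa * t ^+ 2) ->
  (forall s, 0 <= s <= 1 -> x <= e - s * g * tau + kappa * s ^+ 2) ->
  expR x <= 2 - expR (- e) - 6 * tau ^+ 2.
Proof.
move=> /andP[g0 g1] kE /andP[t0 t1] e0 hx hy.
have k0 : 0 < kappa by rewrite kE divr_gt0// exprn_gt0.
have kg3 : g ^+ 3 <= 1 by rewrite exprn_ile1// ltW.
have k1 : kappa <= 1 / 100 by lra.
have tg : tau * g <= 2 * kappa by rewrite -ler_pdivlMr.
have kg2 : 100 * kappa <= g ^+ 2.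
  by rewrite kE (_ : 100 * _ = g ^+ 2 * g); [rewrite ler_piMr ?sqr_ge0|field].
(* For [e >= 2 * kappa] the full move [t = 1] brings [x] down to [kappa], which is enough; otherwise
   both quadratic hypotheses are optimised. *)
have [ke|ke] := leP (2 * kappa) e.
- have h1 : expR (- e) <= 1 - 2 * kappa + 8 * kappa ^+ 2.
    rewrite (@le_trans _ _ (expR (- (2 * kappa))))// ?ler_expR ?lerN2//.
    by rewrite (le_trans (expR_le_quadratic _))//; [lra|nra].
  have h2 : expR x <= 1 + kappa + 2 * kappa ^+ 2.
    have := hx 1; rewrite ler01 lexx subrr mul0r add0r expr1n mulr1 => /(_ isT) xk.
    rewrite (@le_trans _ _ (expR kappa))// ?ler_expR//.
    by apply: expR_le_quadratic; lra.
  have h3 : tau ^+ 2 <= kappa / 25.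
    have : (tau * g) ^+ 2 <= (2 * kappa) ^+ 2.
      by rewrite ler_pXn2r// nnegrE ?mulr_ge0 ?(ltW g0) ?(ltW k0).
    rewrite exprMn => h.
    rewrite -(@ler_pM2r _ (g ^+ 2)) ?exprn_gt0//; apply: (le_trans h).
    nra.
  nra.
- have h1 : expR (- e) <= 1 - e + 2 * e ^+ 2.
    by rewrite (le_trans (expR_le_quadratic _))//; [lra|rewrite sqrrN].
  (* Minimisers of the right sides of [hx] and [hy], which become [e - kappa * a ^+ 2] and
     [e - kappa * s ^+ 2]; [e - G] is their average. *)
  pose a := e / (2 * kappa); pose s := g * tau / (2 * kappa).
  have ea : e = a * (2 * kappa) by rewrite /a divfK// gt_eqF// mulr_gt0.
  have es : g * tau = s * (2 * kappa) by rewrite /s divfK// gt_eqF// mulr_gt0.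
  have a01 : 0 <= a <= 1.
    by rewrite divr_ge0 ?ler_pdivrMr ?mul1r ?mulr_gt0 ?(ltW ke)// mulr_ge0// ltW.
  have s01 : 0 <= s <= 1.
    rewrite divr_ge0 ?ler_pdivrMr ?mul1r ?mulr_gt0 ?mulr_ge0 ?(ltW g0)//.
      by rewrite mulrC.
    exact: ltW.
  clearbody a s.
  pose G := kappa * (a ^+ 2 + s ^+ 2) / 2.
  have xz : x <= e - G.
    have := hx _ a01; have := hy _ s01; rewrite -mulrA es /G ea => A B; lra.
  have G0 : 0 <= G by rewrite /G divr_ge0// mulr_ge0 ?addr_ge0 ?sqr_ge0// ltW.
  have Gk : G <= kappa.
    rewrite /G ler_pdivrMr// ler_wpM2l ?(ltW k0)//.
    by have := exprn_ile1 2 (proj1 (andP a01)) (proj2 (andP a01));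
       have := exprn_ile1 2 (proj1 (andP s01)) (proj2 (andP s01)); lra.
  have h2 : expR x <= 1 + (e - G) + 2 * (e - G) ^+ 2.
    rewrite (@le_trans _ _ (expR (e - G)))// ?ler_expR//.
    by apply: expR_le_quadratic; lra.
  have h3 : (e - G) ^+ 2 <= 2 * e ^+ 2 + 2 * G ^+ 2.
    by have := sqr_ge0 (e + G); nra.
  have h4 : G ^+ 2 <= G / 100 by rewrite expr2 ler_wpM2l//; lra.
  have h5 : tau ^+ 2 <= kappa * s ^+ 2 / 25.
    rewrite -(@ler_pM2r _ (g ^+ 2)) ?exprn_gt0// -exprMn (mulrC tau) es.
    rewrite exprMn (_ : _ * g ^+ 2 = s ^+ 2 * (kappa * g ^+ 2 / 25)); last by field.
    by rewrite ler_wpM2l ?sqr_ge0//; have := ler_wpM2l (ltW k0) kg2; lra.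
  have h6 : e ^+ 2 <= kappa * a ^+ 2 / 25.
    have : a ^+ 2 * (kappa * (1 / 100 - kappa)) >= 0.
      by rewrite mulr_ge0 ?sqr_ge0// mulr_ge0 ?(ltW k0)//; lra.
    by rewrite ea exprMn => ?; lra.
  (* The factor 1/100 in [kappa] makes [G] exceed the sum of all the quadratic terms [6 * tau ^+ 2],
     [6 * e ^+ 2] and [4 * G ^+ 2]. *)
  have h7 : tau ^+ 2 + e ^+ 2 <= G / 12 by move: G0; rewrite /G => ?; lra.
  have h8 := sqr_ge0 tau.
  lra.
Qed.

End ExpBounds.

(** * Lower Riemann sums of nonincreasing functions, and weighted means *)

Lemma integral_ge_lower_sum {R : realType} (G : R -> R) (n : nat) (S : nat -> R) :
  {in `]0, 1]%R, forall u, 0 <= G u} ->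
  {in `]0, 1]%R &, {homo G : u v /~ u <= v}} ->
  (forall j, S j.+1 <= S j) -> S 0%N <= 1 -> S n = 0 ->
  ((\sum_(j < n) (S j - S j.+1) * G (S j))%:E <=
   \int[lebesgue_measure]_(u in `]0%R, S 0%N]) (G u)%:E)%E.
Proof.
move=> G0 Gd.
have mG (a b : R) : 0 <= a -> b <= 1 ->
    measurable_fun (`]a, b]%classic : set R) G.
  move=> a0 b1.
  have sub : (`]a, b]%classic : set R) `<=` `]0, 1]%classic.
    by apply: subset_itv; rewrite bnd_simp.
  apply: (measurable_funS _ sub) => //.
  (* Superlevel sets of a monotone function are intervals, hence measurable. *)
  apply: (measurability (@RGenCInfty.G R)) => [|/= _ [_] [r] -> <-].
    exact: RGenCInfty.measurableE.
  rewrite (_ : _ `&` _ = [set x | `]0, 1]%classic x /\ r <= G x]); last first.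
    by apply/seteqP; split => x/=; rewrite !in_itv/= ?andbT.
  apply: is_interval_measurable => s t /= [s01 rs] [t01 rt] u /andP[su ut].
  move: s01 t01; rewrite !in_itv/= => /andP[s0 s1] /andP[t0 t1].
  have u0 : 0 < u by exact: lt_le_trans su.
  have u1 : u <= 1 by exact: le_trans t1.
  split; first by rewrite u0.
  by apply: (le_trans rt); apply: Gd; rewrite ?in_itv/= ?u0 ?t0.
(* The induction peels off the rightmost cell []S 1, S 0]], on which [G] is at least its value at
   the right end. Cells open on the left avoid 0, where [G] may blow up. *)
elim: n S => [|n IH] S Sd S1 Sn.
  by rewrite big_ord0 Sn set_itv_ge ?bnd_simp ?ltxx// integral_set0.
have Snn j : 0 <= S (n.+1 - j)%N.
  elim: j => [|j IHj]; first by rewrite subn0 Sn.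
  have [nj|nj] := leqP n.+1 j.
    by move: IHj; rewrite (eqP nj) // (_ : (n.+1 - j.+1 = 0)%N)//; lia.
  by rewrite (le_trans IHj)// -(@subnSK j n.+1)// Sd.
have S1n : 0 <= S 1%N by have := Snn n; rewrite subSnn.
have S10 := Sd 0%N.
rewrite big_ord_recl/= EFinD addeC.
have -> : `]0, S 0%N]%classic = `]0, S 1%N] `|` `]S 1%N, S 0%N] :> set R.
  by rewrite -itv_bndbnd_setU// bnd_simp.
rewrite ge0_integral_setU//=; last 3 first.
- by rewrite -itv_bndbnd_setU ?bnd_simp//; apply/measurable_EFinP; exact: mG.
- move=> x H; rewrite lee_fin G0// in_itv/=; case: H => /=; rewrite in_itv/= => /andP[xa xb].
    by rewrite xa (le_trans xb)// (le_trans S10).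
  by rewrite (le_lt_trans S1n)// (le_trans xb).
- apply/disj_setPS => x []/=; rewrite !in_itv/= => /andP[_ x1] /andP[x2 _].
  by move: x1; rewrite leNgt x2.
apply: leeD.
  by apply: (IH (fun j => S j.+1)) => //; rewrite (le_trans S10).
have [e|ne] := eqVneq (S 0%N) (S 1%N).
  rewrite e subrr mul0r integral_ge0// => x/=; rewrite in_itv/= => /andP[a b].
  by move: b; rewrite leNgt a.
have lt10 : S 1%N < S 0%N by rewrite lt_neqAle eq_sym ne.
have -> : ((S 0%N - S 1%N) * G (S 0%N))%:E =
   (\int[lebesgue_measure]_(u in `](S 1%N), (S 0%N)]) (cst (G (S 0%N))%:E u))%E.
  rewrite integral_cst//= lebesgue_measure_itv/= lte_fin lt10.
  by rewrite -EFinB -EFinM mulrC.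
apply: ge0_le_integral => //=.
- by move=> x _; rewrite lee_fin G0// in_itv/= S1 (le_lt_trans S1n).
- apply/measurable_EFinP; exact: mG.
- move=> x; rewrite in_itv/= => /andP[xa xb]; rewrite lee_fin Gd//.
    by rewrite in_itv/= S1 (le_lt_trans S1n).
  by rewrite in_itv/= (le_lt_trans S1n)//= (le_trans xb).
Qed.

Lemma weighted_mean_gt0 {R : realType} (I : finType) (p f : I -> R) :
  (forall i, 0 <= p i) -> \sum_i p i = 1 -> (forall i, 0 < f i) ->
  0 < \sum_i p i * f i.
Proof.
move=> p0 p1 f0; have pf i : 0 <= p i * f i by rewrite mulr_ge0// ltW.
rewrite lt_neqAle sumr_ge0 ?andbT// eq_sym; apply/eqP => s0.
have z : \sum_i p i = 0.
  apply: big1 => i _; have : p i * f i == 0 by rewrite (psumr_eq0P _ s0).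
  by rewrite mulf_eq0 => /orP[/eqP//|/eqP fi]; have := f0 i; rewrite fi ltxx.
by have := @ltr01 R; rewrite -p1 z ltxx.
Qed.

Lemma weighted_mean_itv01 {R : realType} (I : finType) (p f : I -> R) :
  (forall i, 0 <= p i) -> \sum_i p i = 1 -> (forall i, 0 < f i <= 1) ->
  0 < \sum_i p i * f i <= 1.
Proof.
move=> p0 p1 f01; rewrite weighted_mean_gt0//=; last by move=> i; case/andP: (f01 i).
rewrite -p1; apply: ler_sum => i _; rewrite ler_piMr//.
by case/andP: (f01 i).
Qed.

(** * The inequality in one variable, for a discrete law *)

Section OneDimension.
Context {R : realType} (theta xi dxi ddxi w psi : R -> R) (gamma : R).
Hypotheses (htheta : convex_decreasing_theta theta)
  (hxi : inverse_of theta xi) (hd : derivatives_of xi dxi ddxi)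
  (hdd : forall b, 0 < b -> ddxi b <= `|dxi b|)
  (w0 : {in `]0, 1]%R, forall u, 0 <= w u})
  (wd : {in `]0, 1]%R &, {homo w : u v /~ u <= v}})
  (w2 : (\int[lebesgue_measure]_(u in `]0%R, 1%R]) ((w u) ^+ 2)%:E <= 1)%E)
  (hH : condH xi dxi w).
(* [S j] is the probability of the grid indices [>= j], [jm] the index of the
   median. *)
Variables (L jm : nat) (S : nat -> R).
Hypotheses (Sd : forall j, S j.+1 <= S j) (S0 : S 0%N = 1) (SL : S L.+1 = 0)
  (jmL : (jm <= L)%N) (Sjm : S jm.+1 <= 2^-1).

Let p (i : nat) := S i - S i.+1.

Let p_ge0 i : 0 <= p i. Proof. by rewrite subr_ge0. Qed.

Lemma tail_sum k : \sum_(i < k) p i = 1 - S k.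
Proof.
rewrite -S0 -(big_mkord xpredT p) -[in RHS]opprB -telescope_sumr// -sumrN.
by apply: eq_bigr => i _; rewrite opprB.
Qed.

Let p_sum : \sum_(i < L.+1) p i = 1. Proof. by rewrite tail_sum SL subr0. Qed.

(** Beyond [L.+1] the sequence [S] may become negative, whence the second alternative. *)
Lemma tail_ge0_le1 i : 0 <= S i <= 1 \/ (L < i)%N.
Proof.
have [iL|] := leqP i L; [left|by right].
have S_le (j k : nat) : S (j + k)%N <= S j.
  by elim: k => [|k IH]; rewrite ?addn0// addnS (le_trans _ IH).
apply/andP; split; first by rewrite -SL -(subnKC (leqW iL)) S_le.
by rewrite -S0 -[X in S X]add0n S_le.
Qed.

(** The mean is a lower sum for the partition of []0, 1]] by the points [S i]. This carries [condH]
    and the bound on the integral of [w ^+ 2] over to the discrete law. *)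
Lemma tail_mean_le (G : R -> R) (c : R) :
  {in `]0, 1]%R, forall u, 0 <= G u} ->
  {in `]0, 1]%R &, {homo G : u v /~ u <= v}} ->
  (\int[lebesgue_measure]_(u in `]0%R, 1%R]) (G u)%:E <= c%:E)%E ->
  \sum_(i < L.+1) p i * G (S i) <= c.
Proof.
move=> G0 Gd Gc; rewrite -lee_fin; apply: le_trans Gc.
have := integral_ge_lower_sum G0 Gd Sd _ SL; rewrite S0; exact.
Qed.

(** Everything is expanded around the level [b]. Indices up to [jm] yield a gain [6 * tau ^+ 2].
    Above [jm], either [C i] lies below [b] by at most [tau * w (S i)], with a second order error,
    or [D i <= b <= C i], with no error. After averaging, the gain covers the errors and the tangent
    of [xi] at [b] concludes. *)
Lemma one_dim_reference (C D : nat -> R) (b tau : R) :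
  0 <= b -> 0 <= tau <= 1 ->
  (forall i, (i <= L)%N -> 0 <= C i /\ D i <= C i) ->
  (forall i, (i <= jm)%N -> b <= C i /\
     expR (D i - b) <= 2 - expR (- (C i - b)) - 6 * tau ^+ 2) ->
  (forall i, (jm < i <= L)%N -> 0 < S i ->
     (C i <= b /\ b - C i <= tau * w (S i)) \/ (b <= C i /\ D i <= b)) ->
  \sum_(i < L.+1) p i * expR (D i) <=
    expR (theta (\sum_(i < L.+1) p i * xi (C i))).
Proof.
move=> b0 /andP[t0 t1] CD low up.
pose V := \sum_(i < L.+1) p i * xi (C i).
pose s := \sum_(i < L.+1) p i * expR (D i).
have Dl0 : 0 <= - dxi b by rewrite oppr_ge0 (dxi_le0 htheta hxi hd).
have V01 : 0 < V <= 1.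
  apply: (weighted_mean_itv01 (p := fun i : 'I_L.+1 => p i)) => // i.
  by apply: (xi_gt0_le1 hxi); have [] := CD i (leq_ord i).
pose W i := w (S i) ^+ 2; pose Y i := Xi xi dxi (b - tau * w (S i)) b.
(* The bracket collects the corrections to the linear term: the gain up to the median, the error of
   the quadratic bound on [expR], and the remainder [Xi] of [xi]. *)
have point (i : 'I_L.+1) : p i * xi (C i) <=
    p i * xi b + - dxi b * p i - - dxi b * expR (- b) * (p i * expR (D i))
    + (- (6 * tau ^+ 2 * - dxi b) * (if (i < jm.+1)%N then p i else 0)
       + 2 * tau ^+ 2 * - dxi b * (p i * W i) + p i * Y i).
  have [pi0|pi0] := eqVneq (p i) 0.
    by rewrite pi0 if_same !(mul0r, mulr0, addr0, subr0).
  have pi1 : 0 < p i by rewrite lt_neqAle eq_sym pi0 p_ge0.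
  have Si : 0 < S i <= 1.
    case: (tail_ge0_le1 i) => [/andP[Si0 ->]|]; last by rewrite ltnNge leq_ord.
    rewrite andbT lt_neqAle Si0 andbT; apply/eqP => Sz; move: pi1.
    rewrite /p -Sz sub0r; case: (tail_ge0_le1 i.+1) => [/andP[]|]; first lra.
    move=> Li; have -> : i.+1 = L.+1 by apply/eqP; rewrite eqn_leq ltn_ord.
    by rewrite SL oppr0 ltxx.
  have [Ci0 DCi] := CD i (leq_ord i).
  have W0 : 0 <= W i by exact: sqr_ge0.
  have Y0 : 0 <= Y i by apply: (Xi_ge0 htheta hxi hd).
  have E : expR (D i - b) = expR (- b) * expR (D i) by rewrite -expRD addrC.
  suff H : xi (C i) <= xi b + - dxi b * (1 - expR (D i - b)) +
     (- (6 * tau ^+ 2 * - dxi b) * (if (i < jm.+1)%N then 1 else 0)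
       + 2 * tau ^+ 2 * - dxi b * W i + Y i).
    have := ler_wpM2l (ltW pi1) H; rewrite E.
    case: ifP => _; move: (expR (- b)) (expR (D i)) => x1 x2; lra.
  have Z : 0 <= 2 * tau ^+ 2 * - dxi b * W i.
    by rewrite mulr_ge0 // mulr_ge0 // mulr_ge0 // sqr_ge0.
  rewrite ltnS; case: leqP => ijm.
    have [bC hD] := low i ijm.
    have := @xi_exp_bound R theta xi dxi ddxi htheta hxi hd hdd b (C i - b) b0.
    rewrite subr_ge0 => /(_ bC); rewrite addrC subrK => h1.
    have := ler_wpM2l Dl0 hD; move: (expR (D i - b)) (expR (- (C i - b))) h1 => x1 x2.
    by move: Y0 Z; move: (Y i) (W i) (xi (C i)) (xi b) (dxi b) => *; lra.
  have wi0 : 0 <= w (S i) by apply: w0; rewrite in_itv.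
  have ijmL : (jm < i <= L)%N by rewrite ijm leq_ord.
  have [[Cb bC]|[bC Db]] := up i ijmL (proj1 (andP Si)).
    have h1 : expR (D i - b) <= 1 + (C i - b) + 2 * (C i - b) ^+ 2.
      apply: (@le_trans _ _ (expR (C i - b))); first by rewrite ler_expR lerD2r.
      by apply: expR_le_quadratic; lra.
    have h2 : (C i - b) ^+ 2 <= tau ^+ 2 * W i.
      rewrite /W -exprMn -sqrrN opprB ler_pXn2r// nnegrE ?subr_ge0//.
      exact: mulr_ge0.
    have h3 : Xi xi dxi (C i) b <= Y i.
      by apply: (Xi_nonincr htheta hxi hd) => //; lra.
    have h4 : Xi xi dxi (C i) b = xi (C i) - xi b - (C i - b) * dxi b.
      by rewrite /Xi max_l.
    have h5 : 1 - expR (D i - b) >= - (C i - b) - 2 * (tau ^+ 2 * W i) by lra.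
    have := ler_wpM2l Dl0 h5; move: h3; rewrite h4.
    by move: (Y i) (expR (D i - b)) (xi (C i)) (xi b) (W i) (dxi b) => *; lra.
  have h1 : xi (C i) <= xi b by apply: (xi_le htheta hxi).
  have h2 : expR (D i - b) <= 1 by rewrite -expR0 ler_expR subr_le0.
  have h3 : 0 <= - dxi b * (1 - expR (D i - b)) by rewrite mulr_ge0// subr_ge0.
  lra.
have sumW : \sum_(i < L.+1) p i * W i <= 1.
  apply: (@tail_mean_le (fun u => w u ^+ 2)) => //.
    by move=> u _; rewrite sqr_ge0.
  move=> u v u01 v01 uv; rewrite ler_pXn2r// ?nnegrE ?w0//.
  exact: wd.
have sumY : \sum_(i < L.+1) p i * Y i <= tau ^+ 2 * - dxi b.
  apply: (@tail_mean_le (fun u => Xi xi dxi (b - tau * w u) b)) => //.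
  - by move=> u _; apply: (Xi_ge0 htheta hxi hd).
  - move=> u v u01 v01 uv; apply: (Xi_nonincr htheta hxi hd) => //.
      by rewrite lerD2l lerN2 ler_wpM2l// wd.
    by rewrite gerBl mulr_ge0// w0.
  - have := @hH b tau b0; rewrite t0 t1 => /(_ isT).
    by rewrite ler0_norm// (dxi_le0 htheta hxi hd).
have sumlow : \sum_(i < L.+1) (if (i < jm.+1)%N then p i else 0) = 1 - S jm.+1.
  rewrite -(tail_sum jm.+1) -big_mkcond/=; apply/esym.
  exact: (big_ord_widen L.+1 p).
(* Indices up to [jm] carry mass at least 1/2, so the gain is at least [3 * tau ^+ 2 * - dxi b]; the
   errors take 2 of these 3 units through [sumW] and 1 through [sumY]. *)
have Vle : V <= xi b + - dxi b * (1 - expR (- b) * s).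
  have : V <= \sum_(i < L.+1) (p i * xi b + - dxi b * p i - - dxi b * expR (- b) * (p i * expR (D i))
    + (- (6 * tau ^+ 2 * - dxi b) * (if (i < jm.+1)%N then p i else 0)
       + 2 * tau ^+ 2 * - dxi b * (p i * W i) + p i * Y i)).
    by apply: ler_sum => i _; exact: point.
  rewrite !big_split/= sumrN -!mulr_sumr -mulr_suml p_sum sumlow -/s.
  move=> /le_trans; apply; rewrite mul1r mulr1 mulrBr mulr1 !mulrA.
  have Q0 : 0 <= tau ^+ 2 * - dxi b by rewrite mulr_ge0 ?sqr_ge0.
  have h1 := ler_wpM2l Q0 sumW.
  have h2 := ler_wpM2l Q0 Sjm.
  move: h1 h2 sumY; move: (\sum_(i < L.+1) p i * W i) (\sum_(i < L.+1) p i * Y i).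
  move=> x1 x2 h1 h2 sumY.
  move: (expR (- b)) => x3; lra.
(* For [s <= 1] the claim follows from [theta >= 0]; otherwise [ln s] lies in the domain of [xi] and
   it suffices that [V <= xi (ln s)]. *)
have [s1|s1] := leP s 1.
  apply: (le_trans s1); rewrite -expR0 ler_expR.
  exact: (theta_ge0 htheta).
have s0 : 0 < s by exact: lt_trans s1.
have y0 : 0 <= ln s by rewrite ln_ge0// ltW.
rewrite -[X in X <= _](@lnK _ s) ?posrE// ler_expR -[X in X <= _](theta_xi hxi y0).
case/andP: V01 => V0 V1; case/andP: (xi_gt0_le1 hxi y0) => _ xy1.
apply: (theta_le htheta) => //; apply: (le_trans Vle).
have h1 := xi_tangent htheta hxi hd b0 y0.
have h2 : 1 + (ln s - b) <= expR (- b) * s.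
  rewrite -[s in X in _ <= X](@lnK _ s) ?posrE// -expRD addrC [X in expR X]addrC.
  by rewrite addrC; exact: expR_ge1Dx.
have h3 : - dxi b * (1 - expR (- b) * s) <= - dxi b * (b - ln s).
  by rewrite ler_wpM2l//; lra.
apply: le_trans h1; move: h3; move: (_ * (1 - _)) => x; lra.
Qed.


Variables (g kappa : R) (x : nat -> R).
Hypotheses (g01 : 0 < g <= 1) (kE : kappa = g ^+ 3 / 100) (wg : g <= w 2^-1)
  (psi_ge0 : forall y, 0 <= y -> 0 <= psi y)
  (psi_le : forall y z, 0 <= y -> y <= z -> psi y <= psi z)
  (psi_sqr : forall y, 0 <= y <= 1 -> psi y <= y ^+ 2)
  (psi_lin : forall y, 1 <= y -> y <= psi y)
  (x0 : forall i, 0 <= x i) (xd : forall i j, (i <= j)%N -> x i <= x j)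
  (xjm : x jm <= 1)
  (xw : forall j, (jm < j <= L)%N -> 0 < S j -> psi (x j) <= w (S j)).

(** Two cases for the reference level [b]. If [b = C jm], moves toward [jm] and toward the index of
    largest relative drop feed [low_bound]. If [b < C jm], some drop is so large that a full move to
    its index puts [D] below [b] by [kappa * g], as [low_bound_gap] requires. *)
Lemma one_dim (C D : nat -> R) :
  (forall i, (i <= L)%N -> 0 <= C i) ->
  (forall i j, (i <= j)%N -> (j <= L)%N -> C j <= C i) ->
  (forall i j t, (i <= j)%N -> (j <= L)%N -> 0 <= t <= 1 ->
     D i <= (1 - t) * C i + t * C j + kappa * psi (t * (x j - x i))) ->
  \sum_(i < L.+1) p i * expR (D i) <=
    expR (theta (\sum_(i < L.+1) p i * xi (C i))).
Proof.
move=> C0 Cd DC.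
have g0 : 0 < g by case/andP: g01.
have g1 : g <= 1 by case/andP: g01.
have k0 : 0 < kappa by rewrite kE divr_gt0// exprn_gt0.
(* [b = f i0] lowers the value at the median just enough for all the drops
   [b - C j] above the median to be at most [tau0 * w (S j)]. *)
pose tau0 := 2 * kappa / g.
have tau00 : 0 < tau0 by rewrite divr_gt0// mulr_gt0.
have tau0k : 2 * kappa <= tau0.
  by rewrite /tau0 ler_pdivlMr// ler_piMr// mulr_ge0// ltW.
have tau01 : tau0 <= 1.
  rewrite ler_pdivrMr// mul1r kE.
  have : g ^+ 2 * g <= 1 * g by rewrite ler_pM2r// exprn_ile1// ltW.
  by lra.
have psi0 : psi 0 = 0.
  apply/eqP; rewrite eq_le psi_ge0// andbT.
  by have := @psi_sqr 0; rewrite expr0n/= lexx ler01; exact.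
have DCi i : (i <= L)%N -> D i <= C i.
  move=> iL; have := DC i i 0 (leqnn _) iL; rewrite lexx ler01 => /(_ isT).
  by rewrite subr0 !mul0r psi0 mulr0 mul1r !addr0.
have S_le (i j : nat) : (i <= j)%N -> S j <= S i.
  by move=> /subnK <-; elim: (j - i)%N => // k IH; rewrite addSn (le_trans _ IH).
have upS j : (jm < j <= L)%N -> 0 < S j -> 0 < S j <= 1 /\ g <= w (S j).
  move=> /andP[ij jL] Sj0; have Sj2 : S j <= 2^-1 by rewrite (le_trans _ Sjm)// S_le.
  have Sj1 : S j <= 1 by rewrite (le_trans Sj2)//; lra.
  split; first by rewrite Sj0.
  by rewrite (le_trans wg)// wd// in_itv/= ?Sj0//; apply/andP; split; lra.
have psi_x i j : (i <= j)%N -> psi (x j - x i) <= psi (x j).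
  by move=> ij; rewrite psi_le ?subr_ge0 ?xd// gerBl.
have Djm i t : (i <= jm)%N -> 0 <= t <= 1 ->
    D i <= (1 - t) * C i + t * C jm + kappa * t ^+ 2.
  move=> ijm /andP[t0 t1]; apply: (le_trans (DC i jm t ijm jmL _)); first by rewrite t0.
  rewrite lerD2l ler_wpM2l ?(ltW k0)//.
  have h0 : 0 <= x jm - x i by rewrite subr_ge0 xd.
  have h1 : x jm - x i <= 1 by rewrite (le_trans _ xjm)// gerBl.
  have ht : t * (x jm - x i) <= t by rewrite ler_piMr.
  apply: (le_trans (psi_sqr _)).
    by rewrite mulr_ge0// (le_trans ht).
  by rewrite ler_pXn2r// ?nnegrE// mulr_ge0.
(* The fraction [g * s / w (S j)] keeps the displacement at most [s <= 1], where [psi] is at most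
   the square: if [x j <= 1] because [g <= w (S j)], otherwise because
   [x j <= psi (x j) <= w (S j)]. *)
have Dup i j s : (i <= jm)%N -> (jm < j <= L)%N -> 0 < S j -> 0 <= s <= 1 ->
    D i <= (1 - g * s / w (S j)) * C i + (g * s / w (S j)) * C j + kappa * s ^+ 2.
  move=> ijm jj Sj /andP[s0 s1]; have [_ gw] := upS j jj Sj.
  have jL : (j <= L)%N by case/andP: jj.
  have ij : (i <= j)%N by case/andP: jj => /ltnW/(leq_trans ijm).
  have W0 : 0 < w (S j) by exact: lt_le_trans gw.
  have t0 : 0 <= g * s / w (S j) by rewrite divr_ge0 ?mulr_ge0// ltW.
  have gs : g * s <= g by rewrite ler_piMr// ltW.
  have t1 : g * s / w (S j) <= 1 by rewrite ler_pdivrMr// mul1r (le_trans gs).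
  apply: (le_trans (DC i j _ ij jL (_ : 0 <= g * s / w (S j) <= 1))); first by rewrite t0.
  rewrite lerD2l ler_wpM2l ?(ltW k0)//.
  have h0 : 0 <= x j - x i by rewrite subr_ge0 xd.
  have hj : x j - x i <= x j by rewrite gerBl.
  have ts : g * s / w (S j) * (x j - x i) <= s.
    rewrite mulrAC ler_pdivrMr// (mulrC g) -mulrA ler_wpM2l//.
    have [xj|xj] := leP (x j) 1.
      by rewrite (le_trans _ gw)// ler_piMr ?(ltW g0)// (le_trans hj).
    apply: (@le_trans _ _ (x j)); last by rewrite (le_trans (psi_lin (ltW xj)))// xw.
    by rewrite (le_trans _ hj)// ler_piMl.
  apply: (le_trans (psi_sqr _)).
    by rewrite mulr_ge0// (le_trans ts).
  by rewrite ler_pXn2r// ?nnegrE// mulr_ge0.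
(* The default value [C jm] ensures that the minimum of [f] is at most [C jm]. *)
pose f (j : 'I_L.+1) := if (jm < j)%N && (0 < S j) then C j + tau0 * w (S j) else C jm.
have [i0 fi0] : exists i0, forall j, f i0 <= f j.
  by case: (@arg_minP _ _ _ (@ord0 L) xpredT f isT) => i _ H; exists i => j; exact: H.
have up0 (j : 'I_L.+1) : (jm < j)%N && (0 < S j) -> f i0 <= C j + tau0 * w (S j).
  by move=> h; have := fi0 j; rewrite {2}/f h.
have b_jm : f i0 <= C jm by have := fi0 ord0; rewrite {2}/f ltn0.
have b0 : 0 <= f i0.
  rewrite /f; case: ifP => [/andP[h1 h2]|_]; last exact: C0.
  have h1L : (jm < i0 <= L)%N by rewrite h1 leq_ord.
  rewrite addr_ge0 ?C0 ?leq_ord// mulr_ge0 ?(ltW tau00)//.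
  by have [_ /(le_trans (ltW g0))] := upS i0 h1L h2.
have [bE|blt] := leP (C jm) (f i0).
- have {bE b_jm}bE : C jm = f i0 by apply/eqP; rewrite eq_le bE.
  rewrite -{}bE in up0 b0 * => {fi0 f i0}.
  (* [tau] is the maximum of [h], the largest drop below [C jm] in units of [w]; the default 0 makes
     it nonnegative. *)
  pose h (j : 'I_L.+1) := if (jm < j)%N && (0 < S j) then (C jm - C j) / w (S j) else 0.
  have [j1 hj1] : exists j1, forall j, h j <= h j1.
    by case: (@arg_maxP _ _ _ (@ord0 L) xpredT h isT) => i _ H; exists i => j; exact: H.
  have tau_ge0 : 0 <= h j1 by have := hj1 ord0; rewrite {1}/h ltn0.
  have tau_le : h j1 <= tau0.
    rewrite /h; case: ifP => [hj|_]; last exact: ltW.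
    case/andP: (hj) => h1 h2; have h1L : (jm < j1 <= L)%N by rewrite h1 leq_ord.
    have [_ gw] := upS j1 h1L h2.
    by rewrite ler_pdivrMr ?(lt_le_trans g0)// lerBlDl up0.
  apply: (@one_dim_reference C D (C jm) (h j1)) => //.
  + by rewrite tau_ge0 (le_trans tau_le).
  + by move=> i iL; split; [exact: C0|exact: DCi].
  + move=> i ijm; split; first exact: Cd.
    apply: (@low_bound _ g kappa) => //.
    * by rewrite tau_ge0.
    * by rewrite subr_ge0 Cd.
    * by move=> t t01; have := Djm i t ijm t01; lra.
    * move=> s s01; rewrite /h; case: ifP => [hj|_]; last first.
        rewrite mulr0 subr0.
        have := DCi i (leq_trans ijm jmL).
        have : 0 <= kappa * s ^+ 2 by rewrite mulr_ge0 ?sqr_ge0// ltW.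
        lra.
      case/andP: (hj) => h1 h2; have h1L : (jm < j1 <= L)%N by rewrite h1 leq_ord.
      have [_ gw] := upS j1 h1L h2.
      have W0 : 0 < w (S j1) by exact: lt_le_trans gw.
      have := Dup i j1 s ijm h1L h2 s01.
      rewrite (_ : s * g * ((C jm - C j1) / w (S j1)) = g * s / w (S j1) * (C jm - C j1)); last ring.
      have : 0 <= g * s / w (S j1) * (C i - C jm).
        case/andP: s01 => s0 _.
        by rewrite mulr_ge0 ?subr_ge0 ?Cd// divr_ge0 ?mulr_ge0// ltW.
      lra.
  + move=> i iL Si; left; have [_ gw] := upS i iL Si.
    case/andP: iL => h1 h2; split; first by apply: Cd => //; exact: ltnW.
    have iL1 : (i < L.+1)%N by [].
    have := hj1 (Ordinal iL1); rewrite {1}/h/= h1 Si/=.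
    by rewrite ler_pdivrMr// (lt_le_trans g0).
have [hj fE] : (jm < i0)%N && (0 < S i0) /\ f i0 = C i0 + tau0 * w (S i0).
  by move: blt; rewrite /f; case: ifP => // _; rewrite ltxx.
case/andP: (hj) => h1 h2; have h1L : (jm < i0 <= L)%N by rewrite h1 leq_ord.
have [_ gw] := upS i0 h1L h2.
have kw : kappa * g <= kappa * w (S i0) by rewrite ler_wpM2l// ltW.
have tw : 2 * kappa * w (S i0) <= tau0 * w (S i0).
  by rewrite ler_wpM2r// (le_trans (ltW g0)).
have kw0 : 0 < kappa * g by rewrite mulr_gt0.
(* The full move to [i0] costs at most [kappa * w (S i0)], while [C i0] lies below [f i0] by
   [tau0 * w (S i0)], at least twice as much. *)
have Di (i : nat) : (i <= i0)%N -> D i <= f i0 - kappa * g.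
  move=> ii0; have := DC i i0 1 ii0 (leq_ord i0); rewrite ler01 lexx => /(_ isT).
  rewrite subrr mul0r add0r !mul1r => hD.
  have : kappa * psi (x i0 - x i) <= kappa * w (S i0).
    by rewrite ler_wpM2l ?(ltW k0)// (le_trans (psi_x _ _ ii0))// xw.
  rewrite fE; lra.
apply: (@one_dim_reference C D (f i0) tau0) => //.
- by rewrite (ltW tau00).
- by move=> i iL; split; [exact: C0|exact: DCi].
- move=> i ijm; have hC : f i0 <= C i by rewrite (le_trans (ltW blt))// Cd.
  split => //; apply: (@low_bound_gap _ g kappa) => //.
  + by rewrite (ltW tau00) lexx.
  + by rewrite subr_ge0.
  + by have := Di i (leq_trans ijm (ltnW h1)); lra.
- move=> i iL Si; case/andP: (iL) => hi1 hi2.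
  have iL1 : (i < L.+1)%N by [].
  have [Ci|Ci] := leP (C i) (f i0).
    left; split => //; rewrite lerBlDl.
    by apply: (up0 (Ordinal iL1)); rewrite /= hi1.
  (* As [C i0 <= f i0] and [C] is nonincreasing, [C i > f i0] forces [i <= i0], so [Di] applies. *)
  right; split; first exact: ltW.
  apply: (le_trans (Di i _)); last by rewrite gerBl ltW.
  rewrite leqNgt; apply/negP => i0i.
  have := Cd i0 i (ltnW i0i) hi2; rewrite leNgt => /negP; apply.
  apply: le_lt_trans Ci; rewrite fE lerDl mulr_ge0 ?(ltW tau00)//.
  by rewrite (le_trans (ltW g0)).
Qed.

End OneDimension.

(** * Infimal convolution and tensorization over the coordinates *)

Section Tensorization.
Context {R : realType}.

Definition fcons (n : nat) (A : Type) (a : A) (x : 'I_n -> A) : 'I_n.+1 -> A :=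
  fun i => oapp x a (unlift ord0 i).

Definition nonneg_vec (n : nat) (x : 'I_n -> R) := forall i, 0 <= x i.

Lemma nonneg_fcons n (a : R) (x : 'I_n -> R) :
  0 <= a -> nonneg_vec x -> nonneg_vec (fcons a x).
Proof. by move=> a0 x0 i; rewrite /fcons; case: unliftP => [j|] _ /=; [exact: x0|]. Qed.

Lemma fcons0 n (A : Type) (a : A) (x : 'I_n -> A) : fcons a x ord0 = a.
Proof. by rewrite /fcons unlift_none. Qed.

Lemma fconsS n (A : Type) (a : A) (x : 'I_n -> A) i : fcons a x (lift ord0 i) = x i.
Proof. by rewrite /fcons liftK. Qed.

Lemma sum_ffun_ordS n (J : finType) (F : {ffun 'I_n.+1 -> J} -> R) :
  \sum_phi F phi =
  \sum_(j : J) \sum_(phi : {ffun 'I_n -> J}) F (finfun (fcons j phi)).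
Proof.
rewrite pair_bigA/= (reindex (fun u : J * {ffun 'I_n -> J} => finfun (fcons u.1 u.2)))//.
exists (fun phi : {ffun 'I_n.+1 -> J} => (phi ord0, [ffun k => phi (lift ord0 k)])).
  move=> [j phi] _ /=; rewrite ffunE fcons0; congr pair.
  by apply/ffunP => k; rewrite !ffunE fconsS.
move=> phi _; apply/ffunP => i; rewrite ffunE /= /fcons.
by case: unliftP => [k ->|->] //=; rewrite ffunE.
Qed.

(** Hölder's inequality with exponents [1 / (1 - t)] and [1 / t], in a form that includes [t = 0]
    and [t = 1]. Normalising by [expR A] and [expR B] reduces it to pointwise convexity of
    [expR]. *)
Lemma weighted_expR_convex (I : finType) (q a b d : I -> R) (A B k t : R) :
  (forall i, 0 <= q i) -> 0 <= t <= 1 ->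
  \sum_i q i * expR (a i) <= expR A -> \sum_i q i * expR (b i) <= expR B ->
  (forall i, d i <= (1 - t) * a i + t * b i + k) ->
  \sum_i q i * expR (d i) <= expR ((1 - t) * A + t * B + k).
Proof.
move=> q0 /andP[t0 t1] hA hB hd.
have cvx (u v : R) : expR ((1 - t) * u + t * v) <= (1 - t) * expR u + t * expR v.
  set m := (1 - t) * u + t * v.
  have tangent y : expR m * (1 + (y - m)) <= expR y.
    have -> : expR y = expR m * expR (y - m) by rewrite -expRD addrC subrK.
    by rewrite ler_wpM2l ?expR_ge0// expR_ge1Dx.
  have h1 := tangent u; have h2 := tangent v.
  have t1' : 0 <= 1 - t by rewrite subr_ge0.
  have := lerD (ler_wpM2l t1' h1) (ler_wpM2l t0 h2).
  apply: le_trans; rewrite le_eqVlt; apply/orP; left; apply/eqP.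
  by move: (expR m) => E; rewrite /m; ring.
pose E := expR ((1 - t) * A + t * B + k).
apply: (@le_trans _ _ (\sum_i E * ((1 - t) * (expR (- A) * (q i * expR (a i)))
                            + t * (expR (- B) * (q i * expR (b i)))))).
  apply: ler_sum => i _.
  have := cvx (a i - A) (b i - B).
  rewrite !expRD => h.
  have : expR (d i) <= E * expR ((1 - t) * (a i - A) + t * (b i - B)).
    by rewrite /E -expRD ler_expR (le_trans (hd i))// le_eqVlt; apply/orP; left; apply/eqP; ring.
  move=> /le_trans => /(_ (E * ((1 - t) * (expR (a i) * expR (- A)) + t * (expR (b i) * expR (- B))))).
  rewrite ler_wpM2l ?expR_ge0 ?(le_trans _ h) ?expRD// => /(_ isT) h'.
  apply: (le_trans (ler_wpM2l (q0 i) h')); rewrite le_eqVlt; apply/orP; left; apply/eqP.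
  by ring.
rewrite -mulr_sumr -[X in _ <= X]mulr1 ler_wpM2l ?expR_ge0// big_split/= -!mulr_sumr.
have h1 := ler_wpM2l (expR_ge0 (- A)) hA; have h2 := ler_wpM2l (expR_ge0 (- B)) hB.
rewrite -expRD addNr expR0 in h1; rewrite -expRD addNr expR0 in h2.
have t1' : 0 <= 1 - t by rewrite subr_ge0.
have := lerD (ler_wpM2l t1' h1) (ler_wpM2l t0 h2).
by rewrite !mulr1 subrK.
Qed.

Variables (theta xi psi : R -> R) (kappa : R).
Hypotheses (htheta : convex_decreasing_theta theta) (hxi : inverse_of theta xi)
  (kappa_ge0 : 0 <= kappa)
  (psi_ge0 : forall y, 0 <= y -> 0 <= psi y)
  (psi_le : forall y z, 0 <= y -> y <= z -> psi y <= psi z)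
  (psi_cvx : forall t y z, 0 <= t <= 1 -> 0 <= y -> 0 <= z ->
     psi ((1 - t) * y + t * z) <= (1 - t) * psi y + t * psi z).

Definition cost (n : nat) (x y : 'I_n -> R) : R :=
  kappa * \sum_(i < n) psi (Num.max (x i - y i) 0).

Lemma cost_ge0 n (x y : 'I_n -> R) : 0 <= cost x y.
Proof.
by rewrite mulr_ge0// sumr_ge0// => i _; rewrite psi_ge0// le_max lexx orbT.
Qed.

Lemma cost_convex n (x x' y : 'I_n -> R) t : 0 <= t <= 1 ->
  cost (fun i => (1 - t) * x i + t * x' i) y <= (1 - t) * cost x y + t * cost x' y.
Proof.
move=> t01; have /andP[t0 t1] := t01.
rewrite /cost !(mulrCA _ kappa) -mulrDr ler_wpM2l// !mulr_sumr -big_split/=.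
apply: ler_sum => i _.
have m0 (u : R) : 0 <= Num.max u 0 by rewrite le_max lexx orbT.
apply: le_trans (psi_cvx t01 (m0 _) (m0 _)); apply: psi_le => //.
have h1 : x i - y i <= Num.max (x i - y i) 0 by rewrite le_max lexx.
have h2 : x' i - y i <= Num.max (x' i - y i) 0 by rewrite le_max lexx.
have t1' : 0 <= 1 - t by rewrite subr_ge0.
rewrite ge_max; apply/andP; split; last by rewrite addr_ge0// mulr_ge0.
have := lerD (ler_wpM2l t1' h1) (ler_wpM2l t0 h2).
by apply: le_trans; rewrite le_eqVlt; apply/orP; left; apply/eqP; ring.
Qed.

Lemma cost_fcons n (a b : R) (x y : 'I_n -> R) :
  cost (fcons a x) (fcons b y) = kappa * psi (Num.max (a - b) 0) + cost x y.
Proof.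
rewrite /cost big_ord_recl !fcons0 mulrDr; congr (_ + kappa * _).
by apply: eq_bigr => i _; rewrite !fconsS.
Qed.

Definition infconv n (c : ('I_n -> R) -> R) (y : 'I_n -> R) : R :=
  inf [set c x + cost x y | x in [set x | nonneg_vec x]].

Lemma infconv_le n (c : ('I_n -> R) -> R) x y :
  (forall x, nonneg_vec x -> 0 <= c x) -> nonneg_vec x -> infconv c y <= c x + cost x y.
Proof.
move=> c0 x0; apply: ge_inf; last by exists x.
by exists 0 => _ [z z0 <-]; rewrite addr_ge0 ?cost_ge0 ?c0.
Qed.

(** The infima may fail to be attained, so points within [e] of each are inserted in the
    hypothesis. *)
Lemma infconv_mean n (c c' : ('I_n -> R) -> R) y t z : 0 <= t <= 1 ->
  (forall x, nonneg_vec x -> 0 <= c x) -> (forall x, nonneg_vec x -> 0 <= c' x) ->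
  (forall x x', nonneg_vec x -> nonneg_vec x' ->
     z <= (1 - t) * (c x + cost x y) + t * (c' x' + cost x' y)) ->
  z <= (1 - t) * infconv c y + t * infconv c' y.
Proof.
move=> /andP[t0 t1] c0 c'0 hz; apply/ler_addgt0Pr => e e0.
have hinf (c1 : ('I_n -> R) -> R) : (forall x, nonneg_vec x -> 0 <= c1 x) ->
    exists2 x, nonneg_vec x & c1 x + cost x y <= infconv c1 y + e.
  move=> c10.
  have hi : has_inf [set c1 x + cost x y | x in [set x | nonneg_vec x]].
    split; first by exists (c1 (fun=> 0) + cost (fun=> 0) y); exists (fun=> 0).
    by exists 0 => _ [v v0 <-]; rewrite addr_ge0 ?cost_ge0 ?c10.
  by have [_ [x x0 <-] /ltW hx] := inf_adherent e0 hi; exists x.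
have [x x0 hx] := hinf c c0; have [x' x'0 hx'] := hinf c' c'0.
apply: (le_trans (hz x x' x0 x'0)).
have t1' : 0 <= 1 - t by rewrite subr_ge0.
have := lerD (ler_wpM2l t1' hx) (ler_wpM2l t0 hx').
move=> /le_trans; apply; lra.
Qed.

Variables (J : finType) (p g : J -> R).
Hypotheses (p0 : forall j, 0 <= p j) (p1 : \sum_j p j = 1) (g0 : forall j, 0 <= g j)
  (one_dim : forall C D : J -> R, (forall j, 0 <= C j) ->
    (forall i j, g i <= g j -> C j <= C i) ->
    (forall i j t, g i <= g j -> 0 <= t <= 1 ->
      D i <= (1 - t) * C i + t * C j + kappa * psi (t * (g j - g i))) ->
    \sum_j p j * expR (D j) <= expR (theta (\sum_j p j * xi (C j)))).

Definition weight n (phi : {ffun 'I_n -> J}) : R := \prod_i p (phi i).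

Lemma weight_ge0 n (phi : {ffun 'I_n -> J}) : 0 <= weight phi.
Proof. by apply: prodr_ge0. Qed.

Lemma weight_sum n : \sum_(phi : {ffun 'I_n -> J}) weight phi = 1.
Proof.
rewrite /weight -(bigA_distr_bigA (fun=> p)) big1// => i _; exact: p1.
Qed.

Lemma sum_weightS n (F : ('I_n.+1 -> R) -> R) :
  \sum_(phi : {ffun 'I_n.+1 -> J}) weight phi * F (g \o phi) =
  \sum_j p j * \sum_(phi : {ffun 'I_n -> J}) weight phi * F (fcons (g j) (g \o phi)).
Proof.
rewrite sum_ffun_ordS; apply: eq_bigr => j _; rewrite mulr_sumr.
apply: eq_bigr => phi _; rewrite mulrA; congr (_ * F _).
  rewrite /weight big_ord_recl ffunE fcons0; congr (_ * _).
  by apply: eq_bigr => i _; rewrite ffunE fconsS.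
by apply/funext => i; rewrite /fcons/= ffunE /fcons; case: unliftP => /=.
Qed.

(** Induction on the dimension, with the first coordinate frozen at [g j]. The one-variable
    inequality is applied to [C j = theta (V j)] and [D j = ln (s j)]. This [C] is nonincreasing but
    may fail to be convex, which is why [one_dim] assumes monotonicity only. *)
Lemma tensorization n (c d : ('I_n -> R) -> R) :
  (forall x, nonneg_vec x -> 0 <= c x) ->
  (forall t x y, 0 <= t <= 1 -> nonneg_vec x -> nonneg_vec y ->
     c (fun i => (1 - t) * x i + t * y i) <= (1 - t) * c x + t * c y) ->
  (forall x y, nonneg_vec x -> (forall i, x i <= y i) -> c y <= c x) ->
  (forall x y, nonneg_vec x -> nonneg_vec y -> d y <= c x + cost x y) ->
  \sum_(phi : {ffun 'I_n -> J}) weight phi * expR (d (g \o phi)) <=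
  expR (theta (\sum_(phi : {ffun 'I_n -> J}) weight phi * xi (c (g \o phi)))).
Proof.
elim: n c d => [|n IH] c d c0 c_cvx c_anti hd.
  have E (F : ('I_0 -> R) -> R) :
      \sum_(phi : {ffun 'I_0 -> J}) weight phi * F (g \o phi) = F (fun=> 0).
    under eq_bigr => phi _.
      rewrite [g \o phi](_ : _ = (fun=> 0)); last by apply/funext; case.
      over.
    by rewrite -mulr_suml weight_sum mul1r.
  rewrite (E (expR \o d)) (E (xi \o c))/= (theta_xi hxi) ?c0 // ler_expR.
  by have := hd (fun=> 0) (fun=> 0); rewrite /cost big_ord0 mulr0 addr0; exact.
rewrite (sum_weightS (expR \o d)) (sum_weightS (xi \o c))/=.
pose V j := \sum_(phi : {ffun 'I_n -> J}) weight phi * xi (c (fcons (g j) (g \o phi))).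
pose s j := \sum_(phi : {ffun 'I_n -> J}) weight phi * expR (d (fcons (g j) (g \o phi))).
have gphi (phi : {ffun 'I_n -> J}) : nonneg_vec (g \o phi) by move=> i; exact: g0.
have V01 j : 0 < V j <= 1.
  apply: (@weighted_mean_itv01 R _ (@weight n)
    (fun phi => xi (c (fcons (g j) (g \o phi))))) => [phi||phi].
  - exact: weight_ge0.
  - exact: weight_sum.
  - by apply: (xi_gt0_le1 hxi); apply: c0; exact: nonneg_fcons.
have s_gt0 j : 0 < s j.
  apply: (@weighted_mean_gt0 R _ (@weight n)
    (fun phi => expR (d (fcons (g j) (g \o phi))))) => [phi||phi]; [exact: weight_ge0|exact: weight_sum|exact: expR_gt0].
have xiV j : xi (theta (V j)) = V j by exact: (xi_theta hxi (V01 j)).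
have es j : expR (ln (s j)) = s j by rewrite lnK// posrE.
under eq_bigr do rewrite -/(s _) -es.
under [X in _ <= expR (theta X)]eq_bigr do rewrite -/(V _) -xiV.
have c0j j x : nonneg_vec x -> 0 <= c (fcons (g j) x).
  by move=> x0; apply: c0; exact: nonneg_fcons.
apply: (one_dim (C := theta \o V)) => [j|i j gij|i j t gij t01] /=.
- exact: (theta_ge0 htheta).
- have /andP[Vi Vi1] := V01 i; have /andP[Vj Vj1] := V01 j.
  apply: (theta_le htheta) => //; apply: ler_sum => phi _.
  rewrite ler_wpM2l ?weight_ge0//; apply: (xi_le htheta hxi); first exact: c0j.
  apply: c_anti => [|k]; first exact: nonneg_fcons.
  by rewrite /fcons; case: unliftP.
(* The induction hypothesis is used with [d] replaced by the infimal convolution of each slice of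
   [c]; Hölder's inequality then interpolates between the slices [i] and [j]. *)
- have IHj k : \sum_(phi : {ffun 'I_n -> J}) weight phi *
      expR (infconv (fun x => c (fcons (g k) x)) (g \o phi)) <= expR (theta (V k)).
    apply: (IH (fun x => c (fcons (g k) x))).
    + by move=> x x0; exact: c0j.
    + move=> r x y r01 x0 y0.
      have := c_cvx r (fcons (g k) x) (fcons (g k) y) r01.
      rewrite (_ : (fun i => _) = fcons (g k) (fun i => (1 - r) * x i + r * y i)).
        by apply; exact: nonneg_fcons.
      by apply/funext => l; rewrite /fcons; case: unliftP => //= _; ring.
    + move=> x y x0 xy; apply: c_anti; first exact: nonneg_fcons.
      by move=> l; rewrite /fcons; case: unliftP => /=.
    + by move=> x y x0 y0; apply: infconv_le => // z; exact: c0j.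
  rewrite -ler_expR es.
  apply: weighted_expR_convex (IHj i) (IHj j) _ => //; first exact: weight_ge0.
  move=> phi; rewrite -lerBlDr.
  apply: infconv_mean => //.
  + by move=> x; exact: c0j.
  + by move=> x; exact: c0j.
  move=> x x' x0 x'0; have /andP[t0 t1] := t01.
  (* The competitor is the convex combination of the points [(g i, x)] and [(g j, x')]; its first
     coordinate exceeds [g i] by [t * (g j - g i)], the source of the [psi] term. *)
  pose a := (1 - t) * g i + t * g j.
  pose z := fun k => (1 - t) * x k + t * x' k.
  have t1' : 0 <= 1 - t by rewrite subr_ge0.
  have a0 : 0 <= a by rewrite addr_ge0 ?mulr_ge0.
  have z0 : nonneg_vec z by move=> k; rewrite addr_ge0 ?mulr_ge0.
  have h1 := hd (fcons a z) (fcons (g i) (g \o phi)) (nonneg_fcons a0 z0) (nonneg_fcons (g0 i) (gphi phi)).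
  rewrite cost_fcons in h1.
  have aE : a - g i = t * (g j - g i) by rewrite /a; ring.
  rewrite aE max_l ?mulr_ge0 ?subr_ge0// in h1.
  have h2 := cost_convex x x' (g \o phi) t01.
  have h3 : c (fcons a z) <= (1 - t) * c (fcons (g i) x) + t * c (fcons (g j) x').
    have := c_cvx t (fcons (g i) x) (fcons (g j) x') t01 (nonneg_fcons (g0 i) x0) (nonneg_fcons (g0 j) x'0).
    rewrite (_ : (fun i => _) = fcons a z)//.
    by apply/funext => l; rewrite /fcons; case: unliftP.
  rewrite -/z in h2; lra.
Qed.

End Tensorization.

(** * Infima of positive linear forms on the orthant *)

Section InfimumOfSums.
Context {R : realType} (n : nat) (F : set ('I_n -> R)).
Hypotheses (F0 : F !=set0) (Fpos : forall a, F a -> forall i, 0 < a i).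

Definition infsum (x : 'I_n -> R) : R := inf [set \sum_(i < n) a i * x i | a in F].

Lemma sum_ge0 a x : F a -> nonneg_vec x -> 0 <= \sum_(i < n) a i * x i.
Proof. by move=> Fa x0; apply: sumr_ge0 => i _; rewrite mulr_ge0// ltW// Fpos. Qed.

Lemma infsum_le a x : F a -> nonneg_vec x -> infsum x <= \sum_(i < n) a i * x i.
Proof.
move=> Fa x0; apply: ge_inf; last by exists a.
by exists 0 => _ [b Fb <-]; exact: sum_ge0.
Qed.

Lemma le_infsum z x : (forall a, F a -> z <= \sum_(i < n) a i * x i) -> z <= infsum x.
Proof.
move=> h; apply: lb_le_inf; last by move=> _ [a Fa <-]; exact: h.
by case: F0 => a Fa; exists (\sum_(i < n) a i * x i); exists a.
Qed.

Lemma infsum_ge0 x : nonneg_vec x -> 0 <= infsum x.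
Proof. by move=> x0; apply: le_infsum => a Fa; exact: sum_ge0. Qed.

Lemma infsum_scale_le l x y : 0 <= l -> nonneg_vec x -> (forall i, l * x i <= y i) ->
  l * infsum x <= infsum y.
Proof.
move=> l0 x0 xy; apply: le_infsum => a Fa.
apply: (le_trans (ler_wpM2l l0 (infsum_le Fa x0))).
rewrite mulr_sumr; apply: ler_sum => i _; rewrite mulrCA ler_wpM2l//.
by rewrite ltW// Fpos.
Qed.

Lemma infsum_homo x y : nonneg_vec x -> (forall i, x i <= y i) -> infsum x <= infsum y.
Proof.
move=> x0 xy; rewrite -[X in X <= _]mul1r; apply: infsum_scale_le => // i.
by rewrite mul1r.
Qed.

Lemma infsum_concave t x y : 0 <= t <= 1 -> nonneg_vec x -> nonneg_vec y ->
  (1 - t) * infsum x + t * infsum y <= infsum (fun i => (1 - t) * x i + t * y i).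
Proof.
move=> /andP[t0 t1] x0 y0; have t1' : 0 <= 1 - t by rewrite subr_ge0.
apply: le_infsum => a Fa.
apply: (le_trans (lerD (ler_wpM2l t1' (infsum_le Fa x0)) (ler_wpM2l t0 (infsum_le Fa y0)))).
rewrite !mulr_sumr -big_split/= le_eqVlt; apply/orP; left; apply/eqP.
by apply: eq_bigr => i _; ring.
Qed.

(** The strict inequality leaves room for a near-minimiser [a] at [y], whose sum at [x] is at least
    [infsum x]. Thus the positive part of [x - y] is admissible for [PsiF] at [v]. *)
Lemma infsum_excess x y v : nonneg_vec x -> nonneg_vec y ->
  infsum y + v < infsum x ->
  exists2 a, F a & v <= \sum_(i < n) Num.max (x i - y i) 0 * `|a i|.
Proof.
move=> x0 y0 hv.
have hi : has_inf [set \sum_(i < n) a i * y i | a in F].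
  split; first by case: F0 => a Fa; exists (\sum_(i < n) a i * y i); exists a.
  by exists 0 => _ [b Fb <-]; exact: sum_ge0.
have e0 : 0 < infsum x - v - infsum y by lra.
have [_ [a Fa <-] ha] := inf_adherent e0 hi; exists a => //.
have h1 : \sum_(i < n) a i * y i <= infsum x - v.
  by move: ha; rewrite -/(infsum y); lra.
have h2 := infsum_le Fa x0.
have : \sum_(i < n) a i * x i - \sum_(i < n) a i * y i <=
    \sum_(i < n) Num.max (x i - y i) 0 * `|a i|.
  rewrite -sumrB; apply: ler_sum => i _; rewrite gtr0_norm ?Fpos//.
  by rewrite -mulrBr mulrC ler_wpM2r ?le_max ?lexx// ltW// Fpos.
lra.
Qed.

End InfimumOfSums.

(** * Monotonicity and left continuity of [PsiF] *)

Section PsiF.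
Context {R : realType} (n : nat) (F : set ('I_n.+1 -> R)).
Hypotheses (F0 : F !=set0) (Fpos : forall a, F a -> forall i, 0 < a i).

Let admissible u := [set s : 'I_n.+1 -> R | (forall i, 0 <= s i) /\
          exists2 a, F a & u <= \sum_(i < n.+1) s i * `|a i|].

Lemma admissible_nonempty u : admissible u !=set0.
Proof.
case: F0 => a Fa.
exists (fun i => Num.max u 0 / a ord0); split.
  by move=> i; rewrite divr_ge0 ?le_max ?lexx ?orbT// ltW// Fpos.
exists a => //; rewrite big_ord_recl gtr0_norm ?Fpos//.
rewrite divfK ?gt_eqF ?Fpos// (@le_trans _ _ (Num.max u 0)) ?le_max ?lexx//.
rewrite lerDl sumr_ge0// => i _; rewrite mulr_ge0 ?normr_ge0//.
by rewrite divr_ge0 ?le_max ?lexx ?orbT// ltW// Fpos.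
Qed.

(** Serves to pass to the positive part of [psi]. The lower bound [c] makes the infimum for a
    possibly negative [psi] a genuine one. *)
Lemma PsiF_homo_psi (psi psi' : R -> R) (c : R) u :
  (forall y, 0 <= y -> c <= psi y) -> (forall y, 0 <= y -> psi y <= psi' y) ->
  PsiF F psi u <= PsiF F psi' u.
Proof.
move=> hc hp; apply: lb_le_inf.
  have [s hs] := admissible_nonempty u.
  by exists (\sum_(i < n.+1) psi' (s i)); exists s.
move=> _ [s hs <-]; apply: (@le_trans _ _ (\sum_(i < n.+1) psi (s i))).
  apply: ge_inf; last by exists s.
  exists (\sum_(i < n.+1) c) => _ [s' [hs' _] <-].
  by apply: ler_sum => i _; exact: hc.
by apply: ler_sum => i _; apply: hp; case: hs.
Qed.

Variable (psi : R -> R).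
Hypotheses (psi_ge0 : forall y, 0 <= y -> 0 <= psi y)
  (psi_le : forall y z, 0 <= y -> y <= z -> psi y <= psi z)
  (psi_cvx : forall t y z, 0 <= t <= 1 -> 0 <= y -> 0 <= z ->
     psi ((1 - t) * y + t * z) <= (1 - t) * psi y + t * psi z)
  (psi_lin : forall y, 1 <= y -> y <= psi y).

Let PsiF_lbound u : has_lbound [set \sum_(i < n.+1) psi (s i) | s in admissible u].
Proof.
by exists 0 => _ [s [s0 _] <-]; apply: sumr_ge0 => i _; exact: psi_ge0.
Qed.

Lemma PsiF_le u s : admissible u s -> PsiF F psi u <= \sum_(i < n.+1) psi (s i).
Proof. by move=> hs; apply: (ge_inf (PsiF_lbound u)); exists s. Qed.

Lemma PsiF_homo u v : u <= v -> PsiF F psi u <= PsiF F psi v.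
Proof.
move=> uv; apply: lb_le_inf.
  have [s hs] := admissible_nonempty v.
  by exists (\sum_(i < n.+1) psi (s i)); exists s.
move=> _ [s [s0 [a Fa hv]] <-]; apply: PsiF_le; split => //.
by exists a => //; exact: le_trans hv.
Qed.

Lemma PsiF_ge0 u : 0 <= PsiF F psi u.
Proof.
apply: lb_le_inf; last by move=> _ [s [s0 _] <-]; apply: sumr_ge0 => i _; exact: psi_ge0.
have [s hs] := admissible_nonempty u.
by exists (\sum_(i < n.+1) psi (s i)); exists s.
Qed.

Lemma PsiF0 : psi 0 = 0 -> PsiF F psi 0 = 0.
Proof.
move=> p0; apply/eqP; rewrite eq_le PsiF_ge0 andbT.
have := @PsiF_le 0 (fun=> 0); rewrite big1 => [|i _]; last exact: p0.
apply; split => //; case: F0 => a Fa; exists a => //.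
by apply: sumr_ge0 => i _; rewrite mul0r.
Qed.

(** With [u = (1 + l) * v], a near-optimal [s] for [v] becomes admissible for [u] when scaled by
    [1 + l]. Since [(1 + l) * s i] is a convex combination of [s i] and [2 * s i], this adds at most
    [l * B] to the sum. *)
Lemma PsiF_left_continuous u eta : 0 < u -> 0 < eta ->
  exists v, [/\ 0 < v, v < u & PsiF F psi u <= PsiF F psi v + eta].
Proof.
move=> u0 eta0.
(* Bounds every coordinate of a near-optimal [s]: [psi (s i)] is at most the whole sum, and
   [y <= psi y] for [y >= 1]. *)
pose C := PsiF F psi u + 2.
have C0 : 0 <= C by rewrite addr_ge0// PsiF_ge0.
pose B := n.+1%:R * psi (2 * C).
have B0 : 0 <= B by rewrite mulr_ge0// psi_ge0// mulr_ge0.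
pose l := Num.min 1 (eta / (2 * (B + 1))).
have B1 : 0 < 2 * (B + 1) by lra.
have l0 : 0 < l by rewrite lt_min ltr01 divr_gt0.
have l1 : l <= 1 by rewrite ge_min lexx.
have lB : l * B <= eta / 2.
  have : l * (2 * (B + 1)) <= eta by rewrite -ler_pdivlMr// ge_min lexx orbT.
  lra.
have l10 : 0 < 1 + l by lra.
exists (u / (1 + l)); split; first by rewrite divr_gt0.
  by rewrite ltr_pdivrMr// ltr_pMr//; lra.
set v := u / (1 + l).
have uv : u = (1 + l) * v by rewrite /v mulrC divfK// gt_eqF.
have vu : v <= u by rewrite uv; have : 0 < v by [rewrite divr_gt0]; move=> ?; nra.
have e0 : 0 < Num.min 1 (eta / 2) by rewrite lt_min ltr01 divr_gt0.
have hi : has_inf [set \sum_(i < n.+1) psi (s i) | s in admissible v].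
  split; last exact: PsiF_lbound.
  have [s hs] := admissible_nonempty v.
  by exists (\sum_(i < n.+1) psi (s i)); exists s.
have [_ [s [s0 [a Fa hv]] <-]] := inf_adherent e0 hi.
rewrite -/(PsiF F psi v) => hs.
have hs1 : \sum_(i < n.+1) psi (s i) <= PsiF F psi u + 1.
  have := PsiF_homo vu; have : Num.min 1 (eta / 2) <= 1 by rewrite ge_min lexx.
  lra.
have hs2 : \sum_(i < n.+1) psi (s i) <= PsiF F psi v + eta / 2.
  have : Num.min 1 (eta / 2) <= eta / 2 by rewrite ge_min lexx orbT.
  lra.
have sC i : s i <= C.
  have [s1|/ltW s1] := leP (s i) 1; first by have := PsiF_ge0 u; rewrite /C; lra.
  apply: (le_trans (psi_lin s1)).
  have : psi (s i) <= \sum_(i < n.+1) psi (s i).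
    rewrite (bigD1 i)//= lerDl sumr_ge0// => j _; exact: psi_ge0.
  by rewrite /C; lra.
have adm : admissible u (fun i => (1 + l) * s i).
  split; first by move=> i; rewrite mulr_ge0// ltW.
  exists a => //; rewrite uv.
  under eq_bigr do rewrite -mulrA.
  by rewrite -mulr_sumr ler_wpM2l// ltW.
apply: (le_trans (PsiF_le adm)).
have step i : psi ((1 + l) * s i) <= psi (s i) + l * psi (2 * C).
  have s20 : 0 <= 2 * s i by rewrite mulr_ge0.
  have l01 : 0 <= l <= 1 by rewrite (ltW l0).
  have := psi_cvx l01 (s0 i) s20.
  rewrite (_ : (1 - l) * s i + l * (2 * s i) = (1 + l) * s i); last by ring.
  move=> /le_trans; apply.
  have h1 : l * psi (2 * s i) <= l * psi (2 * C).
    by rewrite ler_wpM2l ?(ltW l0)// psi_le// ler_wpM2l.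
  have := mulr_ge0 (ltW l0) (psi_ge0 (s0 i)); lra.
apply: (le_trans (ler_sum _ (fun i _ => step i))).
rewrite big_split/= sumr_const card_ord.
have -> : (l * psi (2 * C)) *+ n.+1 = l * B by rewrite /B -mulr_natl mulrCA.
lra.
Qed.

End PsiF.

(** * Rounding down to a finite grid *)

Section Discretization.
Context {R : realType} (k : nat).

(** With step [1 / k.+1] the grid reaches [k.+1], so resolution and range improve together. *)
Definition mesh_size : nat := k.+1 ^ 2.

Definition mesh (j : nat) : R := j%:R / k.+1%:R.

Definition disc (x : R) : 'I_mesh_size.+1 :=
  inord (minn (Num.truncn (x * k.+1%:R)) mesh_size).

Lemma mesh_ge0 j : 0 <= mesh j. Proof. by rewrite divr_ge0. Qed.

Lemma mesh_homo i j : (mesh i <= mesh j) = (i <= j)%N.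
Proof. by rewrite ler_pM2r ?invr_gt0 ?ltr0n// ler_nat. Qed.

Lemma disc_val x : disc x = minn (Num.truncn (x * k.+1%:R)) mesh_size :> nat.
Proof. by rewrite inordK// ltnS geq_minr. Qed.

(** At grid points rounding leaves tail events unchanged. Index 0 is excluded because negative reals
    are also sent to it. *)
Lemma disc_ge x j : (0 < j <= mesh_size)%N -> (j <= disc x)%N = (mesh j <= x).
Proof.
move=> /andP[j0 jL]; rewrite disc_val leq_min jL andbT.
case: j j0 {jL} => // j _; rewrite Num.Theory.truncn_gt_nat.
by rewrite /mesh ler_pdivrMr// ltr0n.
Qed.

Lemma mesh_disc_le x : 0 <= x -> mesh (disc x) <= x.
Proof.
move=> x0; case E : (disc x : nat) => [|j]; first by rewrite /mesh mul0r.
rewrite -disc_ge; first by rewrite E.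
by rewrite /= -E leq_ord.
Qed.

Lemma disc_homo x y : x <= y -> (disc x <= disc y)%N.
Proof.
move=> xy; case E : (disc x : nat) => [//|j].
have jL : (0 < j.+1 <= mesh_size)%N by rewrite /= -E leq_ord.
by rewrite disc_ge// (le_trans _ xy)// -disc_ge// E.
Qed.

(** Rounding loses at most one cell, which the second alternative bounds by [(1 - l) * x], and
    [x <= k.+1] keeps the cap inactive. The multiplicative form suits the homogeneity of
    [infsum]. *)
Lemma mesh_disc_scale x l : 0 <= x -> 0 <= l -> x <= k.+1%:R ->
  (x = 0 \/ 1 <= (1 - l) * x * k.+1%:R) -> l * x <= mesh (disc x).
Proof.
move=> x0 l0 xk; have k0 : 0 < k.+1%:R :> R by rewrite ltr0n.
case=> [->|hl]; first by rewrite mulr0 mesh_ge0.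
have xk0 : 0 <= x * k.+1%:R by rewrite mulr_ge0.
have trL : (Num.truncn (x * k.+1%:R) <= mesh_size)%N.
  rewrite -(ler_nat R) (@le_trans _ _ (x * k.+1%:R))//.
    by rewrite Num.Theory.truncn_le.
  by rewrite /mesh_size natrX expr2 ler_wpM2r.
rewrite /mesh disc_val (minn_idPl trL) ler_pdivlMr//.
have /andP[_] := Num.Theory.truncn_itv xk0.
rewrite -natr1; lra.
Qed.

End Discretization.

(** * The law of the rounded vector is a product of point masses *)

Section DiscretizedVector.
Context {R : realType} (n : nat) d (T : measurableType d) (P : probability T R)
  (X : 'I_n.+1 -> {RV P >-> R}).
Hypotheses (indep : mutually_independent P (fun i => X i : T -> R))
  (ident : identically_distributed P (fun i => X i : T -> R)).
Variable k : nat.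

Definition disc_vec (x : T) : {ffun 'I_n.+1 -> 'I_(mesh_size k).+1} :=
  [ffun i => disc k (X i x)].

Definition disc_tail (j : nat) : R :=
  fine (P (X ord0 @^-1` [set x | (j <= disc k x)%N])).

Let point_mass (j : 'I_(mesh_size k).+1) : R := disc_tail j - disc_tail j.+1.

Lemma fine_probability (A : set T) : measurable A -> (fine (P A))%:E = P A.
Proof. by move=> mA; rewrite fineK// fin_num_measure. Qed.

Lemma fine_probability_le (A B : set T) : measurable A -> measurable B ->
  A `<=` B -> fine (P A) <= fine (P B).
Proof.
move=> mA mB AB; rewrite -lee_fin !fine_probability//.
by apply: le_measure => //; rewrite inE.
Qed.

Lemma measurable_disc_ge j : measurable [set x : R | (j <= disc k x)%N].
Proof.
have [jL|Lj] := leqP j (mesh_size k); last first.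
  rewrite (_ : [set x | _] = set0); first exact: measurable0.
  by apply/seteqP; split => x //=; rewrite leqNgt (leq_ltn_trans (leq_ord _)).
case: j jL => [|j] jL.
  by rewrite (_ : [set x | _] = setT); [exact: measurableT|apply/seteqP; split].
rewrite (_ : [set x | _] = `[mesh k j.+1, +oo[%classic); first exact: measurable_itv.
by apply/seteqP; split => x /=; rewrite in_itv/= andbT disc_ge.
Qed.

Lemma measurable_disc_eq (j : 'I_(mesh_size k).+1) : measurable [set x : R | disc k x = j].
Proof.
rewrite (_ : [set x | _] = [set x | (j <= disc k x)%N] `\` [set x | (j.+1 <= disc k x)%N]).
  by apply: measurableD; exact: measurable_disc_ge.
apply/seteqP; split => x /=; first by move=> ->; rewrite ltnn leqnn; split.
by move=> [h1 h2]; apply/val_inj/eqP; rewrite /= eqn_leq h1 andbT leqNgt; apply/negP.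
Qed.

Lemma measurable_preimage_rv i (B : set R) : measurable B -> measurable (X i @^-1` B).
Proof.
by move=> mB; exact: measurable_funPTI.
Qed.

Lemma disc_eq_prob i j : P (X i @^-1` [set x | disc k x = j]) = (point_mass j)%:E.
Proof.
rewrite (ident i ord0 (measurable_disc_eq j)).
rewrite (_ : _ @^-1` _ = (X ord0 @^-1` [set x | (j <= disc k x)%N]) `\`
   (X ord0 @^-1` [set x | (j.+1 <= disc k x)%N])); last first.
  apply/seteqP; split => x /=; first by move=> ->; rewrite ltnn leqnn; split.
  by move=> [h1 h2]; apply/val_inj/eqP; rewrite /= eqn_leq h1 andbT leqNgt; apply/negP.
have mA i' : measurable (X ord0 @^-1` [set x | (i' <= disc k x)%N]).
  by apply: measurable_preimage_rv; exact: measurable_disc_ge.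
rewrite measureD//; last first.
  by rewrite (le_lt_trans (probability_le1 P (mA j)))// ltry.
rewrite setIidr; last by move=> x /=; exact: ltnW.
by rewrite /point_mass /disc_tail EFinB !fine_probability.
Qed.

Lemma disc_vec_eq_prob phi :
  measurable [set x | disc_vec x = phi] /\
  P [set x | disc_vec x = phi] = (weight point_mass phi)%:E.
Proof.
have -> : [set x | disc_vec x = phi] =
    \bigcap_(i in [set` [set: 'I_n.+1]%SET]) (X i @^-1` [set x | disc k x = phi i]).
  apply/seteqP; split => x /=.
    by move=> <- i _ /=; rewrite ffunE.
  by move=> h; apply/ffunP => i; rewrite ffunE; apply: h; rewrite /= inE.
split.
  apply: fin_bigcap_measurable => [|i _]; first exact: finite_finpred.
  by apply: measurable_preimage_rv; exact: measurable_disc_eq.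
rewrite (indep _ (B := fun i => [set x | disc k x = phi i])); last first.
  by move=> i; exact: measurable_disc_eq.
under eq_bigr do rewrite disc_eq_prob.
rewrite prodEFin /weight; congr EFin; apply: eq_bigl => i; by rewrite inE.
Qed.

Lemma disc_vec_prob (Q : pred {ffun 'I_n.+1 -> 'I_(mesh_size k).+1}) :
  measurable [set x | Q (disc_vec x)] /\
  fine (P [set x | Q (disc_vec x)]) = \sum_(phi | Q phi) weight point_mass phi.
Proof.
have E : [set x | Q (disc_vec x)] = \bigcup_(phi in [set` Q]) [set x | disc_vec x = phi].
  by apply/seteqP; split => x /= => [Qx|[phi Qphi ->//]]; exists (disc_vec x).
have fQ : finite_set [set` Q] by exact: finite_finpred.
have mE phi : measurable [set x | disc_vec x = phi] by case: (disc_vec_eq_prob phi).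
split; first by rewrite E; apply: fin_bigcup_measurable.
rewrite E measure_fin_bigcup//; last first.
  by move=> phi phi' _ _ [x [/= <- <-]].
rewrite -(bigfs _ (index_enum_uniq _)); last first.
  by move=> phi _; rewrite mem_index_enum.
rewrite (eq_bigr (fun phi => (weight point_mass phi)%:E)) ?sumEFin// => phi _.
by case: (disc_vec_eq_prob phi).
Qed.

End DiscretizedVector.

(** * The deviation inequality, first on the grid and then in the limit *)

Section Deviation.
Context {R : realType} (g kappa : R) (n : nat) (F : set ('I_n.+1 -> R))
  (d : measure_display) (T : measurableType d) (P : probability T R)
  (X : 'I_n.+1 -> {RV P >-> R}) (psi theta xi dxi ddxi w : R -> R) (m : R).
Hypotheses (F0 : F !=set0) (Fpos : forall a, F a -> forall i, 0 < a i)
  (X0 : forall i x, 0 <= X i x)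
  (indep : mutually_independent P (fun i => X i : T -> R))
  (ident : identically_distributed P (fun i => X i : T -> R))
  (g01 : 0 < g <= 1) (kE : kappa = g ^+ 3 / 100) (wg : g <= w 2^-1)
  (psi_ge0 : forall y, 0 <= y -> 0 <= psi y)
  (psi_cvx : forall t y z, 0 <= t <= 1 -> 0 <= y -> 0 <= z ->
     psi ((1 - t) * y + t * z) <= (1 - t) * psi y + t * psi z)
  (psi_sqr : forall y, 0 <= y <= 1 -> psi y <= y ^+ 2)
  (psi_lin : forall y, 1 <= y -> y <= psi y)
  (htheta : convex_decreasing_theta theta) (hxi : inverse_of theta xi)
  (w0 : {in `]0, 1]%R, forall u, 0 <= w u})
  (wd : {in `]0, 1]%R &, {homo w : u v /~ u <= v}})
  (w2 : (\int[lebesgue_measure]_(u in `]0%R, 1%R]) ((w u) ^+ 2)%:E <= 1)%E)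
  (hd : derivatives_of xi dxi ddxi)
  (hdd : forall b, 0 < b -> ddxi b <= `|dxi b|)
  (hH : condH xi dxi w)
  (mX : is_median P (X ord0) m) (m1 : m <= 1)
  (hw : forall t, m <= t ->
    ((psi t)%:E <= w_ext w (fine (P [set x | (t <= X ord0 x)%R])))%E).

Let kappa_gt0 : 0 < kappa.
Proof. by case/andP: g01 => g0 _; rewrite kE divr_gt0// exprn_gt0. Qed.

Lemma psi_at0 : psi 0 = 0.
Proof.
apply/eqP; rewrite eq_le psi_ge0// andbT.
by have := @psi_sqr 0; rewrite expr0n/= lexx ler01; exact.
Qed.

Lemma psi_homo y z : 0 <= y -> y <= z -> psi y <= psi z.
Proof.
move=> y0; rewrite le_eqVlt => /predU1P[->//|yz].
have z0 : 0 < z by exact: le_lt_trans yz.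
have t01 : 0 <= y / z <= 1.
  by rewrite divr_ge0 ?(ltW z0)// ler_pdivrMr// mul1r ltW.
have := psi_cvx t01 (lexx 0) (ltW z0).
rewrite mulr0 add0r divfK ?gt_eqF// psi_at0 mulr0 add0r => /le_trans; apply.
by rewrite ler_piMl ?psi_ge0 ?(ltW z0)//; case/andP: t01.
Qed.

Lemma median_ge0 : 0 <= m.
Proof.
rewrite leNgt; apply/negP => m0; case: mX => + _.
rewrite (_ : [set x | _] = set0); first by rewrite measure0 lee_fin; lra.
by apply/seteqP; split => x //=; rewrite leNgt (lt_le_trans m0).
Qed.

Section Mesh.
Variable k : nat.

Let S := disc_tail X k.
Let p (j : 'I_(mesh_size k).+1) : R := S j - S j.+1.

Let mS j : measurable (X ord0 @^-1` [set x | (j <= disc k x)%N]).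
Proof. by apply: measurable_preimage_rv; exact: measurable_disc_ge. Qed.

Lemma disc_tail_nonincr j : S j.+1 <= S j.
Proof. by apply: fine_probability_le => // x /=; exact: ltnW. Qed.

Lemma disc_tail0 : S 0 = 1.
Proof.
rewrite /S /disc_tail (_ : _ @^-1` _ = setT) ?probability_setT//.
by apply/seteqP; split.
Qed.

Lemma disc_tail_last : S (mesh_size k).+1 = 0.
Proof.
rewrite /S /disc_tail (_ : _ @^-1` _ = set0) ?measure0//.
by apply/seteqP; split => x //=; rewrite ltnNge leq_ord.
Qed.

Lemma disc_tail_median : S (disc k m).+1 <= 2^-1.
Proof.
have mA : measurable [set x | X ord0 x <= m].
  rewrite (_ : [set x | _] = X ord0 @^-1` `]-oo, m]%classic).
    by apply: measurable_preimage_rv; exact: measurable_itv.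
  by apply/seteqP; split => x /=; rewrite in_itv.
apply: (@le_trans _ _ (fine (P (~` [set x | X ord0 x <= m])))).
  apply: fine_probability_le => //; first exact: measurableC.
  move=> x /= h /(disc_homo k); rewrite leqNgt => /negP; exact.
rewrite probability_setC// -lee_fin fineK ?fin_numB ?fin_num_measure//.
case: mX => + _; rewrite -(fine_probability P mA) -EFinB !lee_fin; lra.
Qed.

Lemma disc_tail_w j : (disc k m < j <= mesh_size k)%N -> 0 < S j ->
  psi (mesh k j) <= w (S j).
Proof.
move=> /andP[mj jL] Sj.
have j0 : (0 < j)%N by exact: leq_ltn_trans mj.
have mlt : m <= mesh k j.
  by rewrite ltW// ltNge -disc_ge ?j0// -ltnNge.
have := hw mlt.
rewrite (_ : [set x | _] = X ord0 @^-1` [set x | (j <= disc k x)%N]); last first.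
  by apply/seteqP; split => x /=; rewrite disc_ge ?j0.
by rewrite /w_ext -/(disc_tail X k j) -/S gt_eqF// lee_fin.
Qed.

Lemma disc_one_dim (C D : 'I_(mesh_size k).+1 -> R) :
  (forall j, 0 <= C j) ->
  (forall i j : 'I_(mesh_size k).+1, mesh k i <= mesh k j :> R -> C j <= C i) ->
  (forall (i j : 'I_(mesh_size k).+1) t, mesh k i <= mesh k j :> R -> 0 <= t <= 1 ->
    D i <= (1 - t) * C i + t * C j + kappa * psi (t * (mesh k j - mesh k i))) ->
  \sum_j p j * expR (D j) <= expR (theta (\sum_j p j * xi (C j))).
Proof.
move=> C0 Cd DC.
have := @one_dim R theta xi dxi ddxi w psi htheta hxi hd hdd w0 wd w2 hH
  (mesh_size k) (disc k m) S disc_tail_nonincr disc_tail0 disc_tail_last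
  (leq_ord _) disc_tail_median g kappa (mesh k) g01 kE wg psi_ge0 psi_homo
  psi_sqr psi_lin (@mesh_ge0 R k).
have mesh_le i j : (i <= j)%N -> mesh k i <= mesh k j :> R by rewrite mesh_homo.
move=> /(_ mesh_le (le_trans (mesh_disc_le k median_ge0) m1) disc_tail_w).
move=> /(_ (C \o inord) (D \o inord)) H.
have -> : \sum_j p j * expR (D j) = \sum_(j < (mesh_size k).+1) p j * expR ((D \o inord) j).
  by apply: eq_bigr => i _; rewrite /= inord_val.
have -> : \sum_j p j * xi (C j) = \sum_(j < (mesh_size k).+1) p j * xi ((C \o inord) j).
  by apply: eq_bigr => i _; rewrite /= inord_val.
apply: H => [i _|i j ij jL|i j t ij jL t01]; first exact: C0.
- apply: Cd; rewrite mesh_le// !inordK ?ltnS//; exact: leq_trans jL.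
- have iL : (i <= mesh_size k)%N by exact: leq_trans jL.
  have := DC (inord i) (inord j) t; rewrite !inordK ?ltnS//.
  by move=> /(_ (mesh_le _ _ ij) t01).
Qed.

Let mesh_vec (phi : {ffun 'I_n.+1 -> 'I_(mesh_size k).+1}) : 'I_n.+1 -> R :=
  (fun j : 'I_(mesh_size k).+1 => mesh k j) \o phi.

Definition disc_inf (x : T) : R := infsum F (mesh_vec (disc_vec X k x)).

(** Tensorization with [c], a multiple of the positive part of [a - e - infsum F x], and [D], equal
    to [K] where [infsum F y <= a - u] and 0 elsewhere. It yields [r * expR K <= expR (theta V)],
    while [q <= V] because [c] vanishes where [infsum F x >= a - e]. *)
Lemma disc_inf_deviation a u v : 0 <= v -> v < u ->
  let q := fine (P [set x | a - (u - v) / 2 <= disc_inf x]) in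
  let r := fine (P [set x | disc_inf x <= a - u]) in
  0 < r -> q <= xi (Num.max (ln r + kappa * PsiF F psi v) 0).
Proof.
move=> v0 vu q r r0.
(* [c] rises from 0 at level [a - e] to [K] at level [a - 2 * e = a - u + v]; above the latter, [x]
   exceeds [y] by more than [v] and the cost alone is at least [K]. *)
pose e := (u - v) / 2; have e0 : 0 < e by rewrite divr_gt0// subr_gt0.
pose K := kappa * PsiF F psi v.
have K0 : 0 <= K by rewrite mulr_ge0 ?(ltW kappa_gt0)// PsiF_ge0.
pose c (x : 'I_n.+1 -> R) := K / e * Num.max (a - e - infsum F x) 0.
pose D (y : 'I_n.+1 -> R) := if infsum F y <= a - u then K else 0.
have Ke0 : 0 <= K / e by rewrite divr_ge0// ltW.
have c0 x : 0 <= c x by rewrite mulr_ge0// le_max lexx orbT.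
have ph := @tensorization R theta xi psi kappa htheta hxi (ltW kappa_gt0) psi_ge0
  psi_homo psi_cvx _ p (fun j => mesh k j).
have p0 j : 0 <= p j by rewrite subr_ge0; exact: disc_tail_nonincr.
have p1 : \sum_j p j = 1.
  have := tail_sum disc_tail0 (mesh_size k).+1.
  by rewrite disc_tail_last subr0.
have mv0 phi : nonneg_vec (mesh_vec phi) by move=> i; exact: mesh_ge0.
pose V := \sum_(phi : {ffun 'I_n.+1 -> 'I_(mesh_size k).+1}) weight p phi * xi (c (mesh_vec phi)).
have {ph} hV : \sum_(phi : {ffun 'I_n.+1 -> 'I_(mesh_size k).+1}) weight p phi * expR (D (mesh_vec phi)) <= expR (theta V).
  apply: (ph p0 p1 (fun j => mesh_ge0 k j) disc_one_dim n.+1 c D) => //.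
  - move=> t x y t01 x0 y0; have /andP[t0 t1] := t01.
    have t1' : 0 <= 1 - t by rewrite subr_ge0.
    rewrite /c !(mulrCA _ (K / e)) -mulrDr ler_wpM2l//.
    have hz := infsum_concave F0 Fpos t01 x0 y0.
    have h1 : a - e - infsum F x <= Num.max (a - e - infsum F x) 0 by rewrite le_max lexx.
    have h2 : a - e - infsum F y <= Num.max (a - e - infsum F y) 0 by rewrite le_max lexx.
    rewrite ge_max; apply/andP; split; last first.
      by rewrite addr_ge0// mulr_ge0// le_max lexx orbT.
    have := lerD (ler_wpM2l t1' h1) (ler_wpM2l t0 h2).
    by apply: le_trans; lra.
  - move=> x y x0 xy; rewrite /c ler_wpM2l//.
    have := infsum_homo F0 Fpos x0 xy.
    by move=> h; rewrite ge_max !le_max lexx orbT andbT lerB.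
  - move=> x y x0 y0; rewrite /D; case: ifP => [hy|_]; last first.
      by rewrite addr_ge0// cost_ge0// ltW.
    have [hx|hx] := leP (infsum F x) (a - 2 * e).
      rewrite ler_wpDr ?cost_ge0 ?(ltW kappa_gt0)//.
      have he : e <= Num.max (a - e - infsum F x) 0.
        by rewrite le_max; apply/orP; left; lra.
      by have := ler_wpM2l Ke0 he; rewrite divfK// gt_eqF.
    have hxy : infsum F y + v < infsum F x.
      by apply: le_lt_trans hx; rewrite /e; lra.
    rewrite ler_wpDl// /cost /K ler_wpM2l ?(ltW kappa_gt0)//.
    apply: PsiF_le => //; split; first by move=> i; rewrite le_max lexx orbT.
    exact: (infsum_excess F0 Fpos x0 y0 hxy).
have V01 : 0 < V <= 1.
  apply: (@weighted_mean_itv01 R _ (@weight R _ p n.+1) (fun phi => xi (c (mesh_vec phi)))).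
  - by move=> phi; exact: weight_ge0.
  - exact: weight_sum.
  - by move=> phi; exact: (xi_gt0_le1 hxi).
have qV : q <= V.
  have -> : q = \sum_(phi | a - e <= infsum F (mesh_vec phi)) weight p phi.
    by have [_] := disc_vec_prob indep ident (fun phi => a - e <= infsum F (mesh_vec phi)).
  rewrite big_mkcond/=; apply: ler_sum => phi _.
  have wp := weight_ge0 p0 phi.
  case: ifP => h; last first.
    by rewrite mulr_ge0// ltW//; case/andP: (xi_gt0_le1 hxi (c0 (mesh_vec phi))).
  rewrite /c max_r; first by rewrite mulr0 (xi0 htheta hxi) mulr1.
  by rewrite subr_le0.
have rV : r * expR K <= expR (theta V).
  apply: le_trans hV.
  have -> : r = \sum_(phi | infsum F (mesh_vec phi) <= a - u) weight p phi.
    by have [_] := disc_vec_prob indep ident (fun phi => infsum F (mesh_vec phi) <= a - u).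
  rewrite big_mkcond/= mulr_suml; apply: ler_sum => phi _.
  have wp := weight_ge0 p0 phi.
  by rewrite /D; case: ifP => // _; rewrite mul0r mulr_ge0// expR_ge0.
have yV : ln r + K <= theta V by rewrite -ler_expR expRD lnK.
have mV : Num.max (ln r + K) 0 <= theta V.
  by rewrite ge_max yV (theta_ge0 htheta).
apply: (le_trans qV); rewrite -[X in X <= _](xi_theta hxi V01).
by apply: (xi_le htheta hxi) => //; rewrite le_max lexx orbT.
Qed.

Lemma disc_inf_le x : disc_inf x <= infsum F (fun i => X i x).
Proof.
apply: infsum_homo => // i; first exact: mesh_ge0.
by rewrite /mesh_vec/= ffunE mesh_disc_le.
Qed.

Lemma measurable_disc_inf (B : set R) : measurable (disc_inf @^-1` B).
Proof.
have [+ _] := disc_vec_prob indep ident (fun phi => `[< B (infsum F (mesh_vec phi)) >]).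
by congr measurable; apply/seteqP; split => x /= /asboolP.
Qed.

End Mesh.

Let Z (x : T) : R := infsum F (fun i => X i x).

Let Xnn x : nonneg_vec (fun i => X i x). Proof. by move=> i; exact: X0. Qed.

(** A factor [l < 1] is chosen with [l * Z x >= Z x - e]; for fine grids every rounded coordinate is
    at least [l * X i x], and homogeneity concludes. *)
Lemma disc_inf_ge x e : 0 < e -> exists K, forall k, (K <= k)%N -> Z x - e <= disc_inf k x.
Proof.
move=> e0; have Z0 : 0 <= Z x by exact: infsum_ge0.
pose e1 := Num.min 1 e; have e10 : 0 < e1 by rewrite lt_min ltr01.
have e11 : e1 <= 1 by rewrite ge_min lexx.
have e1e : e1 <= e by rewrite ge_min lexx orbT.
have Z1 : 0 < Z x + 1 by lra.
pose l := 1 - e1 / (Z x + 1).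
have ll : 0 < 1 - l by rewrite /l opprB addrC subrK divr_gt0.
have l0 : 0 <= l.
  by rewrite subr_ge0 ler_pdivrMr// mul1r (le_trans e11)// lerDr.
have lZ : (1 - l) * Z x <= e.
  rewrite /l opprB addrC subrK (le_trans _ e1e)// mulrAC ler_pdivrMr//.
  by rewrite ler_wpM2l ?(ltW e10)// lerDl.
(* The first summand keeps [X i x] within the grid, the second makes a cell at most
   [(1 - l) * X i x]; for a zero coordinate the inverse is 0 by convention. *)
pose N i := Num.truncn (X i x + ((1 - l) * X i x)^-1).
exists (\max_i N i)%N => k hk.
apply: (@le_trans _ _ (l * Z x)); first by lra.
apply: infsum_scale_le => // i; rewrite /= ffunE.
have Nk : (N i <= k)%N by apply: leq_trans hk; exact: leq_bigmax.
have hN : X i x + ((1 - l) * X i x)^-1 < k.+1%:R.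
  rewrite (lt_le_trans (Num.Theory.truncnS_gt _))// ler_nat ltnS.
  exact: Nk.
have iv0 : 0 <= ((1 - l) * X i x)^-1 by rewrite invr_ge0 mulr_ge0// ltW.
apply: mesh_disc_scale => //; first by have := X0 i x; lra.
have [->|xn0] := eqVneq (X i x) 0; [by left|right].
have xp : 0 < X i x by rewrite lt_neqAle eq_sym xn0 X0.
have lx : 0 < (1 - l) * X i x by rewrite mulr_gt0.
rewrite -ler_pdivrMl// mulr1 (le_trans _ (ltW hN))// lerDr; exact: X0.
Qed.

(** [F] may be uncountable; [Z] is measurable as the pointwise limit of the finitely valued
    [disc_inf k]. *)
Lemma measurable_infsum : measurable_fun setT (Z : T -> R).
Proof.
apply: (@measurable_fun_cvg _ _ _ setT disc_inf) => [k|x _].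
  by move=> _ B _; rewrite setTI; exact: measurable_disc_inf.
apply/cvgrPdist_le => e e0; have [K hK] := disc_inf_ge x e0.
exists K => // k /= Kk; rewrite ger0_norm; first by have := hK k Kk; lra.
by rewrite subr_ge0; exact: disc_inf_le.
Qed.

Lemma measurable_infsum_ge a : measurable [set x | a <= Z x].
Proof.
rewrite (_ : [set x | _] = setT `&` (Z @^-1` `[a, +oo[%classic)).
  by apply: measurable_infsum => //; exact: measurable_itv.
by apply/seteqP; split => x /=; rewrite in_itv/= andbT// => -[].
Qed.

Lemma measurable_infsum_le a : measurable [set x | Z x <= a].
Proof.
rewrite (_ : [set x | _] = setT `&` (Z @^-1` `]-oo, a]%classic)).
  by apply: measurable_infsum => //; exact: measurable_itv.
by apply/seteqP; split => x /=; rewrite in_itv/=// => -[].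
Qed.

(** The events [E j], where [a - e <= disc_inf k] for all [k >= j], increase to a set containing
    [a <= Z]; continuity from below gives the index. *)
Lemma disc_inf_tail a e eta : 0 < e -> 0 < eta ->
  exists k, fine (P [set x | a <= Z x]) - eta <= fine (P [set x | a - e <= disc_inf k x]).
Proof.
move=> e0 eta0.
pose B k := [set x | a - e <= disc_inf k x].
have mB k : measurable (B k).
  rewrite (_ : B k = disc_inf k @^-1` [set y | a - e <= y])//.
  exact: measurable_disc_inf.
pose E j := \bigcap_(k in [set k | (j <= k)%N]) B k.
have mE j : measurable (E j) by apply: bigcap_measurableType => k _.
have mU : measurable (\bigcup_j E j) by apply: bigcup_measurable => k _.
have ndE : nondecreasing_seq E.
  by move=> i j ij; apply/subsetPset => x h k /= jk; apply: h => /=; exact: leq_trans jk.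
have /fine_cvgP[_ ] : P (E j) @[j --> \oo] --> (fine (P (\bigcup_j E j)))%:E.
  by rewrite fine_probability//; exact: nondecreasing_cvg_mu.
move=> /cvgrPdist_le/(_ _ eta0)[K _ /(_ K (leqnn K))] /= hK.
exists K.
have h1 : fine (P [set x | a <= Z x]) <= fine (P (\bigcup_j E j)).
  apply: fine_probability_le => //; first exact: measurable_infsum_ge.
  move=> x /= ax; have [K' hK'] := disc_inf_ge x e0.
  by exists K' => // k /= /hK'; rewrite /B/=; lra.
have h2 : fine (P (E K)) <= fine (P (B K)).
  by apply: fine_probability_le => // x; apply => /=.
by move: hK; rewrite ler_norml /B => /andP[_]; lra.
Qed.

(** Passage to the limit. Rounding down only enlarges the lower event, and the slack [u - v] handles
    the upper one; left continuity of [PsiF] and the Lipschitz bound on [xi] absorb the errors. *)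
Lemma infsum_deviation a u :
  let q := fine (P [set x | a <= Z x]) in
  let r := fine (P [set x | Z x <= a - u]) in
  0 <= u -> 0 < r -> 0 <= ln r + kappa * PsiF F psi u ->
  q <= xi (ln r + kappa * PsiF F psi u).
Proof.
move=> q r u0 r0; set y := ln r + _ => y0.
have q1 : q <= 1.
  by rewrite -lee_fin fine_probability ?probability_le1//; exact: measurable_infsum_ge.
have r1 : r <= 1.
  by rewrite -lee_fin fine_probability ?probability_le1//; exact: measurable_infsum_le.
move: u0; rewrite le_eqVlt => /predU1P[uE|u0].
  have -> : y = 0.
    apply/eqP; rewrite eq_le y0 andbT /y -uE (PsiF0 F0 Fpos) ?psi_at0// mulr0 addr0.
    exact: ln_le0.
  by rewrite (xi0 htheta hxi).
apply/ler_addgt0Pr => e e0.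
have d0 : 0 <= - dxi 0 by rewrite oppr_ge0 (dxi_le0 htheta hxi hd).
(* Makes the loss [eta] in probability plus the Lipschitz loss [- dxi 0 * kappa * eta] equal to
   [e / 2]. *)
pose eta := e / 2 / (1 - dxi 0 * kappa).
have D0 : 0 < 1 - dxi 0 * kappa.
  by have := mulr_ge0 d0 (ltW kappa_gt0); lra.
have eta0 : 0 < eta by rewrite divr_gt0// divr_gt0.
have etaE : eta - dxi 0 * kappa * eta = e / 2.
  by rewrite /eta; field; rewrite gt_eqF.
have [v [v0 vu hv]] := PsiF_left_continuous F0 Fpos psi_ge0 psi_homo psi_cvx psi_lin u0 eta0.
have uv0 : 0 < (u - v) / 2 by rewrite divr_gt0// subr_gt0.
have [k hk] := disc_inf_tail a uv0 eta0.
have rk : r <= fine (P [set x | disc_inf k x <= a - u]).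
  apply: fine_probability_le; first exact: measurable_infsum_le.
    rewrite (_ : [set x | _] = disc_inf k @^-1` [set y | y <= a - u])//.
    exact: measurable_disc_inf.
  by move=> x /=; apply: le_trans; exact: disc_inf_le.
have hq := @disc_inf_deviation k a u v (ltW v0) vu (lt_le_trans r0 rk).
pose y' := Num.max (ln r + kappa * PsiF F psi v) 0.
have y'0 : 0 <= y' by rewrite le_max lexx orbT.
have hq' : q - eta <= xi y'.
  apply: (le_trans hk); apply: (le_trans hq); apply: (xi_le htheta hxi) => //.
  rewrite ge_max !le_max lexx orbT andbT lerD2r ler_ln ?rk// ?posrE//.
  exact: lt_le_trans rk.
have vuPsi : PsiF F psi v <= PsiF F psi u by apply: PsiF_homo => //; exact: ltW.
have kv : kappa * PsiF F psi v <= kappa * PsiF F psi u by rewrite ler_wpM2l// ltW.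
have kv' : kappa * PsiF F psi u <= kappa * (PsiF F psi v + eta) by rewrite ler_wpM2l// ltW.
have yy' : y' <= y by rewrite ge_max y0 andbT /y lerD2l.
have yk : y - y' <= kappa * eta.
  have : ln r + kappa * PsiF F psi v <= y' by rewrite le_max lexx.
  by rewrite /y; lra.
have := xi_lipschitz htheta hxi hd y'0 yy'.
have := ler_wpM2l d0 yk.
lra.
Qed.

End Deviation.

(** * The two tail bounds around the median *)

Theorem theorem8p2p3 (R : realType) (gamma : R) (gamma_gt0 : 0 < gamma) :
  exists2 K : R, 0 < K &
  forall (n : nat) (F : set ('I_n.+1 -> R))
    (d : measure_display) (T : measurableType d) (P : probability T R)
    (X : 'I_n.+1 -> {RV P >-> R})
    (psi theta xi dxi ddxi w : R -> R) (dtheta1 m M : R),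
  F !=set0 ->
  (forall a, F a -> forall i, 0 < a i) ->
  (forall i x, 0 <= X i x) ->
  mutually_independent P (fun i => X i : T -> R) ->
  identically_distributed P (fun i => X i : T -> R) ->
  convex_function (`[0, +oo[%classic : set R^o) psi ->
  psi 0 = 0 ->
  (forall x, 0 <= x <= 1 -> psi x <= x ^+ 2) ->
  (forall x, 1 <= x -> x <= psi x) ->
  convex_decreasing_theta theta ->
  inverse_of theta xi ->
  {in `]0, 1]%R, forall u, 0 <= w u} ->
  {in `]0, 1]%R &, {homo w : u v /~ u <= v}} ->
  {in `]0, 1]%R, forall u, w u <= theta u} ->
  (\int[lebesgue_measure]_(u in `]0%R, 1%R]) ((w u) ^+ 2)%:E <= 1)%E ->
  derivatives_of xi dxi ddxi ->
  is_lderive theta 1 dtheta1 ->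
  {in `]0, +oo[%R &, {homo ddxi : b c /~ b <= c}} ->
  (forall b, 0 < b -> ddxi b <= `|dxi b|) ->
  (forall b, 0 <= b -> gamma * `|dxi b| <= `|dxi (b + 1)|) ->
  gamma <= `|dtheta1| ->
  gamma <= w (2^-1) ->
  condH xi dxi w ->
  is_median P (X ord0) m ->
  m <= 1 ->
  (forall t, m <= t ->
    ((psi t)%:E <= w_ext w (fine (P [set x | (t <= X ord0 x)%R])))%E) ->
  is_median P (Zinf F (fun i => X i : T -> R)) M ->
  (forall u, 0 <= u ->
    (P [set x | (Zinf F (fun i => X i : T -> R) x <= M - u)%R] <=
     (expR (theta (2^-1) - K^-1 * PsiF F psi u))%:E)%E) /\
  (forall u, 0 <= u ->
    (P [set x | (M + u <= Zinf F (fun i => X i : T -> R) x)%R] <=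
     (xi_ext xi (K^-1 * PsiF F psi u - ln 2))%:E)%E).
Proof.
(* The elementary estimates use [g <= 1]. The constant is the inverse of [kappa], so it depends on
   [gamma] only. *)
pose g := Num.min gamma 1.
have g0 : 0 < g by rewrite lt_min gamma_gt0 ltr01.
have g01 : 0 < g <= 1 by rewrite g0 ge_min lexx orbT.
have gg : g <= gamma by rewrite ge_min lexx.
pose kappa := g ^+ 3 / 100.
have kappa_gt0 : 0 < kappa by rewrite divr_gt0// exprn_gt0.
exists kappa^-1; first by rewrite invr_gt0.
move=> n F d T P X psi theta xi dxi ddxi w dtheta1 m M F0 Fpos X0 indep ident.
move=> psi_convex psi0 psi_sqr psi_lin htheta hxi w0 wd _ w2 hd _ _ hdd _ _ wg hH.
move=> mX m1 hw [M1 M2]; rewrite invrK.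
(* [psi] may be negative on [0, 1]; its positive part satisfies the same
   hypotheses and has a larger [PsiF]. *)
pose psi' y := Num.max (psi y) 0.
have psi'_ge0 y : 0 <= y -> 0 <= psi' y by rewrite le_max lexx orbT.
have psi_cvx t y z : 0 <= t <= 1 -> 0 <= y -> 0 <= z ->
    psi ((1 - t) * y + t * z) <= (1 - t) * psi y + t * psi z.
  move=> t01 y0 z0.
  have tI : Itv.spec (@Itv.num_sem R) (Itv.Real `[0%Z, 1%Z]) t.
    by apply/and3P; split; rewrite ?num_real// bnd_simp; case/andP: t01.
  have := psi_convex (Itv.mk tI : {i01 R}) z y.
  rewrite !inE/= !in_itv/= y0 z0 => /(_ isT isT).
  by rewrite !convRE/= [X in psi X]addrC [X in _ <= X -> _]addrC.
have psi'_cvx t y z : 0 <= t <= 1 -> 0 <= y -> 0 <= z ->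
    psi' ((1 - t) * y + t * z) <= (1 - t) * psi' y + t * psi' z.
  move=> t01 y0 z0; have /andP[t0 t1] := t01.
  have t1' : 0 <= 1 - t by rewrite subr_ge0.
  have hy : psi y <= psi' y by rewrite le_max lexx.
  have hz : psi z <= psi' z by rewrite le_max lexx.
  rewrite ge_max (le_trans (psi_cvx t y z t01 y0 z0))/=.
    by rewrite addr_ge0// mulr_ge0// le_max lexx orbT.
  by rewrite lerD// ler_wpM2l.
have psi'_sqr y : 0 <= y <= 1 -> psi' y <= y ^+ 2.
  by move=> y01; rewrite ge_max psi_sqr// sqr_ge0.
have psi'_lin y : 1 <= y -> y <= psi' y.
  by move=> y1; rewrite le_max psi_lin.
have psi_lb y : 0 <= y -> - `|psi 2| <= psi y.
  move=> y0; have p2 := ler_norm (psi 2).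
  have [y1|y1] := leP 1 y.
    by have := psi_lin y y1; have := normr_ge0 (psi 2); lra.
  have y01 : 0 <= y <= 1 by rewrite y0 ltW.
  have half : 0 <= (2^-1 : R) <= 1 by apply/andP; split; lra.
  have y2 : 0 <= 2 - y by lra.
  have := psi_cvx 2^-1 y (2 - y) half y0 y2.
  rewrite (_ : (1 - 2^-1) * y + 2^-1 * (2 - y) = 1); last by field.
  have := psi_cvx y 2 1 y01 (ler0n _ 2) ler01.
  rewrite (_ : (1 - y) * 2 + y * 1 = 2 - y); last by ring.
  have p1 : psi 1 = 1.
    apply/eqP; rewrite eq_le psi_lin// andbT.
    by have := psi_sqr 1; rewrite lexx ler01 expr1n; exact.
  rewrite p1 => h1 h2.
  have : (1 - y) * psi 2 <= (1 - y) * `|psi 2| by rewrite ler_wpM2l//; lra.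
  have : 0 <= y * `|psi 2| by rewrite mulr_ge0.
  lra.
have PsiFle u : kappa * PsiF F psi u <= kappa * PsiF F psi' u.
  rewrite ler_wpM2l ?(ltW kappa_gt0)//; apply: PsiF_homo_psi psi_lb _ => //.
  by move=> y _; rewrite le_max lexx.
have hw' t : m <= t -> ((psi' t)%:E <= w_ext w (fine (P [set x | (t <= X ord0 x)%R])))%E.
  move=> mt; have := hw t mt; rewrite /w_ext; case: eqVneq => [_ _|pne]; first by rewrite leey.
  rewrite !lee_fin ge_max => ->/=; apply: w0; rewrite in_itv/=.
  have mA : measurable [set x | t <= X ord0 x].
    rewrite (_ : [set x | _] = X ord0 @^-1` `[t, +oo[%classic).
      by apply: measurable_preimage_rv; exact: measurable_itv.
    by apply/seteqP; split => x /=; rewrite in_itv/= andbT.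
  rewrite -lee_fin fine_probability// probability_le1// andbT.
  by rewrite lt_neqAle eq_sym pne fine_ge0.
have dev a u := @infsum_deviation R g kappa n F d T P X psi' theta xi dxi ddxi w m
  F0 Fpos X0 indep ident g01 erefl (le_trans gg wg) psi'_ge0 psi'_cvx psi'_sqr
  psi'_lin htheta hxi w0 wd w2 hd hdd hH mX m1 hw' a u.
have mge a := measurable_infsum_ge F0 Fpos X0 indep ident a.
have mle a := measurable_infsum_le F0 Fpos X0 indep ident a.
have half01 : 0 < (2^-1 : R) <= 1 by apply/andP; split; lra.
split=> u u0.
  rewrite -(fine_probability P (mle (M - u))) lee_fin.
  set r := fine _; have r0 : 0 <= r by rewrite fine_ge0.
  move: r0; rewrite le_eqVlt => /predU1P[<-|r0]; first exact: expR_ge0.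
  rewrite -[X in X <= _]lnK ?posrE// ler_expR.
  suff : ln r + kappa * PsiF F psi' u <= theta 2^-1 by have := PsiFle u; lra.
  have [y0|y0] := ltP (ln r + kappa * PsiF F psi' u) 0.
    by rewrite (le_trans (ltW y0))// (theta_ge0 htheta).
  have := dev M u u0 r0 y0.
  have q2 : 2^-1 <= fine (P [set x | M <= infsum F (fun i => X i x)]).
    by rewrite -lee_fin fine_probability//; exact: M2.
  move=> /(le_trans q2) h; rewrite -[X in X <= _](theta_xi hxi y0).
  by apply: (theta_le htheta); [lra|exact: h|case/andP: (xi_gt0_le1 hxi y0)].
rewrite -(fine_probability P (mge (M + u))) lee_fin.
rewrite /xi_ext; case: ltP => y0.
  by rewrite -lee_fin fine_probability// probability_le1.
have := dev (M + u) u u0; rewrite addrK.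
set r := fine (P [set x | _ <= M]) => H.
have r2 : 2^-1 <= r by rewrite -lee_fin fine_probability//; exact: M1.
have r0 : 0 < r by lra.
have lr : - ln 2 <= ln r by rewrite -lnV ?posrE// ler_ln// posrE.
have yy : kappa * PsiF F psi u - ln 2 <= ln r + kappa * PsiF F psi' u.
  by have := PsiFle u; lra.
apply: (le_trans (H r0 (le_trans y0 yy))).
exact: (xi_le htheta hxi).
Qed.
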